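(* Let $q$ be a power of an odd prime and $E,F\subset\mathbb F_q^d$. (1) If $d\geq 2$ is even and $|E||F|\geq 16q^d$, then $$ |\Delta(E,F)|\geq \begin{cases} \frac{q}{144} &\text{if } 1\le |E|< q^{\frac{d-1}{2}},\\[2pt] \frac{1}{144} \min\left\{ q, \frac{|F|}{ 2q^{\frac{d-1}{2}}}\right\} &\text{if } q^{\frac{d-1}{2}}\leq |E|< q^{\frac{d+1}{2}},\\[2pt] \frac{1}{144} \min\left\{ q, \frac{2|E||F|}{q^d}\right\} &\text{if } q^{\frac{d+1}{2}}\leq |E|\leq q^{d}.\end{cases}$$ (2) If $d=2$ and $|E||F|\geq 16q^2$, then $$|\Delta(E,F)|\geq \frac{1}{72}\min\left\{\frac{q}{2},\ \frac{|E|^{1/2}|F|}{\sqrt3\, q}\right\}.$$ (3) If $d=2$, $E,F$ are nonempty, and $-1$ is not a square in $\mathbb F_q$ (no hypothesis on $|E||F|$), then $$|\Delta(E,F)|\geq \min\left\{\frac{q}{2},\ \frac{|E|^{1/2}|F|}{2(\sqrt3+1)q}\right\}.$$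
   Context: $\mathbb F_q$ is the finite field with $q$ elements, of characteristic greater than two. For $m=(m_1,\dots,m_d)\in\mathbb F_q^d$ put $\|m\|=m_1^2+\dots+m_d^2\in\mathbb F_q$. For $E,F\subset\mathbb F_q^d$ the distance set is $\Delta(E,F)=\{\|x-y\|\in\mathbb F_q: x\in E,\ y\in F\}$. *)

(* Defs.v *)
From HB Require Import structures.
From mathcomp Require Import all_boot all_order all_algebra all_field.
Set Implicit Arguments. Unset Strict Implicit. Unset Printing Implicit Defensive.
Import Order.TTheory GRing.Theory Num.Theory.
Local Open Scope ring_scope.

Definition sqnorm (K : finFieldType) (d : nat) (m : 'rV[K]_d) : K :=
  \sum_(i < d) (m 0 i) ^+ 2.

Definition dist_set (K : finFieldType) (d : nat) (E G : {set 'rV[K]_d}) : {set K} :=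
  [set sqnorm (x - y) | x in E, y in G].

(* Main.v *)
Require Import Defs.
From HB Require Import structures.
From mathcomp Require Import all_boot all_order all_algebra all_field.
From mathcomp Require Import complex zify ring lra.
Set Implicit Arguments. Unset Strict Implicit. Unset Printing Implicit Defensive.
Import Order.TTheory GRing.Theory Num.Theory Normc.
Local Open Scope ring_scope.

(** All bounds come from the second moment of [nu t], the number of pairs in
    [E * G] at distance [t]: by Cauchy-Schwarz [(\sum_t nu t)^2 <= D * \sum_t (nu t)^2].
    The exponential sums [A s = \sum_t nu t * psi (s t)] are turned, by the Gauss
    sum identity for [psi (s * sqnorm z)], into sums over spheres in frequency
    space, so the second moment is governed by the mass [M_r] of the Fourier
    transform of [E] on the spheres of radius [r != 0].  In even dimension the
    zero radius only disturbs [nu 0], which the hypothesis [16 q^d <= e f] makes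
    negligible.

    The mass [M_r] is bounded in two ways.  In the plane, a fourth-moment
    argument uses that two circles of the same nonzero radius meet in at most
    two points.  In even dimension the Fourier transform of a sphere is a
    Kloosterman sum [Kl], and [|Kl| <= 3 sqrt q] is needed.  For this, the
    [L]-function of the Kloosterman sum is [1 + Kl T + q T^2], so the
    Kloosterman sums [S_n] over the extensions of degree [n] satisfy
    [S_(n+2) + Kl S_(n+1) + q S_n = 0] and would grow at least like
    [(2 sqrt q)^n] if [|Kl| > 3 sqrt q]; Stepanov's polynomial method shows
    [|S_n| = O(q^(n/2))] for odd [n], the implied constant depending on [q]. *)

(** * Stepanov's method *)

(** The constant 3 in [3 * sqrt q], in place of Weil's 2, keeps the Kloosterman input elementary:
    the recursion for [S_n] is used only through the reverse triangle inequality, without factoring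
    [1 + Kl T + q T^2]. Growth like [(2 sqrt q)^n] beats [q^(n/2)] times any constant, so one large
    odd degree gives the contradiction.

    Stepanov's method bounds the fibres of the trace only from above. The matching lower bound comes
    from the fibres partitioning the nonzero elements, and the deficits are then summed against the
    character.

    The thresholds in (1) come from the mass bound [w^2 e + 3 w e^2] with [w = q^((d-1)/2)]: its
    terms are of the same order at [e = w]. From [e = q^((d+1)/2)] on, the second moment estimate
    that ignores spheres is at least as good.

    The constants leave room: the energy inequalities give [q/16], [min/48] and [min/3] in the three
    cases of (1), and [min/32] in (2). *)

Lemma exists_linear_relation (L : fieldType) (I J : finType) (F : I -> J -> L) :
  (#|J| < #|I|)%N ->
  exists2 c : I -> L, (exists i, c i != 0) & forall j, \sum_i c i * F i j = 0.
Proof.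
move=> ltJI; pose A := \matrix_(i < #|I|, j < #|J|) F (enum_val i) (enum_val j).
have : kermx A != 0.
  rewrite kermx_eq0 /row_free; apply: contraTneq ltJI => <-.
  by rewrite -leqNgt rank_leq_col.
case/rowV0Pn=> v /sub_kermxP vA0 /rV0Pn[k vk].
exists (fun i => v 0 (enum_rank i)); first by exists (enum_val k); rewrite enum_valK.
move=> j; have := congr1 (fun B : 'rV_#|J| => B 0 (enum_rank j)) vA0.
rewrite !mxE => rel; rewrite -[RHS]rel (reindex (@enum_val I I)) /=; last first.
  by apply: onW_bij; apply: enum_val_bij.
by apply: eq_bigr => i _; rewrite mxE enum_valK enum_rankK.
Qed.

Lemma comp_polyXaddC_coef (R : comNzRingType) (p : {poly R}) (c : R) i :
  (p \Po ('X + c%:P))`_i = p^`N(i).[c].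
Proof.
rewrite /comp_poly addrC nderiv_taylor; last exact: mulrC.
have -> : \sum_(i0 < size (map_poly polyC p)) (map_poly polyC p)^`N(i0).[c%:P] * 'X^i0
   = \poly_(i0 < size (map_poly polyC p)) p^`N(i0).[c].
  rewrite poly_def; apply: eq_bigr => k _.
  by rewrite nderivn_map horner_map mul_polyC.
rewrite coef_poly; case: ltnP => // lei.
rewrite nderivn_poly0 ?horner0 //.
by rewrite -(size_map_inj_poly (@polyC_inj R) (polyC0 R) p).
Qed.

(** Taylor expansion at [c]. Divided derivatives are required because ordinary ones do not detect
    the order of a zero beyond the characteristic, and the order used later is a power of [q]. *)
Lemma dvdp_XsubC_exp_nderivn (F : fieldType) (p : {poly F}) (c : F) (n : nat) :
  (forall i, (i < n)%N -> p^`N(i).[c] = 0) -> ('X - c%:P) ^+ n %| p.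
Proof.
move=> p0; have /dvdpP[u Du] : 'X^n %| p \Po ('X + c%:P).
  apply/modp_eq0P; apply/polyP => i; rewrite -Pdiv.IdomainMonic.take_poly_modp.
  by rewrite coef_take_poly coef0 comp_polyXaddC_coef; case: ltnP => // /p0.
rewrite -(comp_polyXaddC_K p c) Du comp_polyM; apply: dvdp_mull.
by rewrite comp_Xn_poly.
Qed.

Section FrobeniusSum.
Variables (L : fieldType) (q : nat) (a b : L).

(** For [a], [b] in the field of [q] elements and [x] fixed by the power [q ^ k], this is the trace
    of [a * x + b / x] down to that field. *)
Definition frobsum (k : nat) (x : L) : L :=
  \sum_(i < k) (a * x ^+ (q ^ i) + b * x^-1 ^+ (q ^ i)).

(* [frobsum k] with denominators cleared by ['X^N]. *)
Definition frobpoly (k N : nat) : {poly L} :=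
  \sum_(i < k) (a *: 'X^(N + q ^ i) + b *: 'X^(N - q ^ i)).

Lemma frobsumD k l x :
  frobsum (k + l) x = frobsum k x + frobsum l (x ^+ (q ^ k)).
Proof.
rewrite /frobsum big_split_ord /=; congr (_ + _).
by apply: eq_bigr => i _; rewrite -exprVn -!exprM expnD.
Qed.

Lemma horner_frobpoly k N (x : L) : x != 0 -> (forall i : 'I_k, q ^ i <= N)%N ->
  (frobpoly k N).[x] = x ^+ N * frobsum k x.
Proof.
move=> x0 leN; rewrite /frobpoly /frobsum horner_sum mulr_sumr.
apply: eq_bigr => i _; rewrite !hornerE mulrDr exprD mulrCA; congr (_ + _).
have -> : x ^+ N = x ^+ (N - q ^ i) * x ^+ (q ^ i) by rewrite -exprD subnK.
by rewrite [RHS]mulrCA exprVn -mulrA mulfV ?mulr1 // expf_neq0.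
Qed.

Lemma size_frobpoly k N : (forall i : 'I_k, q ^ i <= N)%N ->
  (size (frobpoly k N) <= (2 * N).+1)%N.
Proof.
move=> leN; apply: (leq_trans (size_sum _ _ _)); apply/bigmax_leqP => i _.
have := leN i; move: (q ^ i)%N => v leNv.
apply: (leq_trans (size_polyD _ _)); rewrite geq_max; apply/andP; split;
  apply: (leq_trans (size_scale_leq _ _)); rewrite size_polyXn; lia.
Qed.

(** Only the last summand reaches degree [2 * q ^ k]; its [b] part is a constant. *)
Lemma size_frobpoly_top k : (1 < q)%N -> a != 0 ->
  size (frobpoly k.+1 (q ^ k)) = (2 * q ^ k).+1 /\
  lead_coef (frobpoly k.+1 (q ^ k)) = a.
Proof.
move=> q1 a0; rewrite /frobpoly big_ord_recr /=.
set r := \sum_(i < k) _; set N := (q ^ k)%N.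
have N0 : (0 < N)%N by rewrite expn_gt0 (ltnW q1).
have sr : (size r < (2 * N).+1)%N.
  apply: (leq_ltn_trans (size_sum _ _ _)); rewrite ltnS; apply/bigmax_leqP => i _.
  have : (q ^ i < N)%N by rewrite ltn_exp2l.
  move: (q ^ i)%N => v ltv.
  apply: (leq_trans (size_polyD _ _)); rewrite geq_max; apply/andP; split;
  apply: (leq_trans (size_scale_leq _ _)); rewrite size_polyXn; lia.
have sa : size (a *: 'X^(N + N)) = (2 * N).+1.
  by rewrite size_scale // size_polyXn; lia.
have sb : (size (r + b *: 'X^(N - N))%R < size (a *: 'X^(N + N)))%N.
  rewrite sa; apply: (leq_ltn_trans (size_polyD _ _)); rewrite gtn_max sr /=.
  by apply: (leq_ltn_trans (size_scale_leq _ _)); rewrite size_polyXn; lia.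
rewrite addrA addrAC addrC; split; first by rewrite size_polyDl.
by rewrite lead_coefDl // lead_coefZ lead_coefXn mulr1.
Qed.

End FrobeniusSum.

Section Stepanov.
Variables (L : fieldType) (q mu : nat) (a b c : L).
Hypotheses (q_gt2 : (2 < q)%N) (pcharq : [pchar L].-nat q) (a_neq0 : a != 0).

(** The degree [mu.+1 + mu.+2] cuts the trace into [mu.+1] terms in [x] and [mu.+2] terms in
    [x ^+ M]. Here [M = q * w] and [Q = q * M ^ 2], so the expected main term [Q / q] of a fibre is
    [M ^ 2]. *)
Let w := (q ^ mu)%N.
Let M := (q ^ mu.+1)%N.
Let Q := (q ^ (mu.+1 + mu.+2))%N.

Let q_gt1 : (1 < q)%N. Proof. exact: ltn_trans q_gt2. Qed.
Let w_gt0 : (0 < w)%N. Proof. by rewrite expn_gt0 (ltnW q_gt1). Qed.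
Let M_gt0 : (0 < M)%N. Proof. by rewrite expn_gt0 (ltnW q_gt1). Qed.
Let MqE : M = (q * w)%N. Proof. by rewrite /M expnS. Qed.
Let QE : Q = (M * (q * M))%N. Proof. by rewrite /Q expnD -expnS. Qed.

Let low := frobpoly q a b mu.+1 w.
Let high := frobpoly q a b mu.+2 M.
(** The middle factors of [W] and [G] complete the cleared denominators to a power independent of
    [i], so that one scalar relates all [G i j] to the [W i j] at a solution. The last factor of
    [G i j] becomes [x ^+ j] there, since [(x ^+ M) ^+ (q * M) = x ^+ Q = x]. *)
Let W (i : 'I_q) (j : 'I_w.+1) : {poly L} :=
  (c *: 'X^w - low) ^+ i * 'X^(w * (q.-1 - i)) * 'X^j.
Let G (i : 'I_q) (j : 'I_w.+1) : {poly L} :=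
  high ^+ i * 'X^(M * (q.-1 - i)) * 'X^(q * M * j).

Let le_low (i : 'I_mu.+1) : (q ^ i <= w)%N.
Proof. by rewrite leq_exp2l // -ltnS. Qed.
Let le_high (i : 'I_mu.+2) : (q ^ i <= M)%N.
Proof. by rewrite leq_exp2l // -ltnS. Qed.

Let solution (x : L) := [/\ x != 0, x ^+ Q = x & frobsum q a b (mu.+1 + mu.+2) x = c].

(* On solutions the trace splits as [low + high = c] and [x ^+ Q = x], so the
   Frobenius-power factors [G] agree with the low-degree factors [W]. *)
Let horner_GW x i j : solution x ->
  (G i j).[x ^+ M] = (x ^+ M) ^+ (M * q.-1) / x ^+ (w * q.-1) * (W i j).[x].
Proof.
case=> x0 xQ Tx; have y0 : x ^+ M != 0 by rewrite expf_neq0.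
have Elow : (c *: 'X^w - low).[x] = x ^+ w * frobsum q a b mu.+2 (x ^+ M).
  rewrite !hornerE horner_frobpoly // -Tx frobsumD -/M.
  by ring.
have iq : (i <= q.-1)%N by rewrite -ltnS prednK ?ltn_ord // ltnW // ltnW.
have split_exp (y : L) N : (y ^+ N) ^+ i * y ^+ (N * (q.-1 - i)) = y ^+ (N * q.-1).
  by rewrite -exprM -exprD -mulnDr subnKC.
have -> : (W i j).[x] = x ^+ (w * q.-1) * frobsum q a b mu.+2 (x ^+ M) ^+ i * x ^+ j.
  rewrite /W !hornerM horner_exp Elow !hornerXn exprMn -split_exp; ring.
have -> : (G i j).[x ^+ M]
   = (x ^+ M) ^+ (M * q.-1) * frobsum q a b mu.+2 (x ^+ M) ^+ i * x ^+ j.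
  rewrite /G !hornerM horner_exp horner_frobpoly // !hornerXn exprMn -split_exp.
  rewrite [(x ^+ M) ^+ (q * M * j)]exprM -[(x ^+ M) ^+ (q * M)]exprM -QE xQ; ring.
by field; rewrite expf_neq0.
Qed.

Let size_W i j : (size (W i j) <= 2 * w * q.-1 + w.+1)%N.
Proof.
have iq : (i <= q.-1)%N by rewrite -ltnS prednK ?ltn_ord // ltnW // ltnW.
have jw : (j <= w)%N by rewrite -ltnS ltn_ord.
rewrite /W; apply: (leq_trans (size_polyMleq _ _)); rewrite size_polyXn addnS /=.
have s1 : (size (c *: 'X^w - low)%R <= (2 * w).+1)%N.
  apply: (leq_trans (size_polyD _ _)); rewrite size_polyN geq_max size_frobpoly // andbT.
  by apply: (leq_trans (size_scale_leq _ _)); rewrite size_polyXn; lia.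
have s2 : (size ((c *: 'X^w - low) ^+ i)%R <= (2 * w * i).+1)%N.
  apply: (leq_trans (size_poly_exp_leq _ _)); rewrite ltnS leq_mul2r.
  by apply/orP; right; lia.
have := size_polyMleq ((c *: 'X^w - low) ^+ i) 'X^(w * (q.-1 - i)).
rewrite size_polyXn => s3; rewrite -mulnA in s2.
have aux (u v x y z k l : nat) : (v <= (2 * x).+1 -> u <= (v + y.+1).-1 ->
  x + y = z -> x <= z -> l <= k -> u + l <= 2 * z + k.+1)%N by lia.
rewrite -mulnA; apply: (aux _ _ _ _ _ _ _ s2 s3) => //.
  by rewrite -mulnDr subnKC.
by rewrite leq_mul2l iq orbT.
Qed.

Let size_lead_G i j :
  size (G i j) = (M * (q.-1 + (i + q * j))).+1 /\ lead_coef (G i j) = a ^+ i.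
Proof.
have iq : (i <= q.-1)%N by rewrite -ltnS prednK ?ltn_ord // ltnW // ltnW.
have [sh lh] := size_frobpoly_top b mu.+1 q_gt1 a_neq0.
split; last by rewrite /G !lead_coefM !lead_coefXn !mulr1 lead_coef_exp lh.
have h0 : high != 0 by rewrite -size_poly_eq0 sh.
rewrite /G !size_mulXn ?mulf_neq0 ?expf_neq0 ?polyX_eq0 //.
have -> : size (high ^+ i) = (2 * M * i).+1.
  by rewrite -(prednK (n := size _)) ?lt0n ?size_poly_eq0 ?expf_neq0 // size_exp sh.
rewrite !addnS; congr _.+1.
have : (M * i + M * (q.-1 - i) = M * q.-1)%N by rewrite -mulnDr subnKC.
rewrite !mulnDr -(mulnA 2%N) (mulnC q M) (mulnA M q) => <-.
by rewrite mul2n -addnn; ring.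
Qed.

(** After substituting ['X^M], the degrees of the [G i j] are distinct multiples of [A], the pair
    being read off from [i + q * j] with [i < q]. Coefficients of size at most [A] then never let
    two nonzero summands share a leading degree. *)
Let A := (M * M)%N.
Let Idx := ('I_q * 'I_w.+1)%type.
Let key (ij : Idx) : nat := (ij.1 + q * ij.2)%N.

Let key_inj : injective key.
Proof.
move=> [i j] [k l]; rewrite /key /= => E; have q0 := ltnW q_gt1.
have Ei : i = k :> nat.
  by have := congr1 (modn^~ q) E; rewrite ![(_ + q * _)%N]addnC ![(q * _)%N]mulnC !modnMDl !modn_small.
have Ej : j = l :> nat.
  by move: E; rewrite Ei => /addnI/eqP; rewrite eqn_pmul2l // => /eqP.
by congr (_, _); apply: val_inj.
Qed.

(* There are [A * q * (w + 1)] unknown coefficients against [M * Bd] linear conditions. *)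
Let exists_coefs : exists2 r : Idx -> {poly L},
  (forall ij, size (r ij) <= A)%N /\ (exists ij, r ij != 0) &
  forall l, (l < M)%N -> \sum_ij (r ij)^`N(l) * W ij.1 ij.2 = 0.
Proof.
pose Bd := (A + (2 * w * q.-1 + w.+1))%N.
pose F (u : 'I_A * Idx) (v : 'I_M * 'I_Bd) : L :=
  (('X^(u.1))^`N(v.1) * W u.2.1 u.2.2)`_v.2.
have cnt : (#|{: 'I_M * 'I_Bd}| < #|{: 'I_A * Idx}|)%N.
  rewrite !card_prod !card_ord /Bd /A.
  (* As [M = q * w], one has [q * (w + 1) = M + q], and the claim reduces to
     [2 * w * (q - 1) + w + 1 < M * q], that is [1 < w * (q - 1) ^ 2]. This is where [q > 2]
     enters. *)
  have aux (x y z : nat) : (0 < x -> 2 < y -> z = y * x ->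
    z * (z * z + (2 * x * y.-1 + x.+1)) < z * z * (y * x.+1))%N.
    move=> x0 y2 zE; have z0 : (0 < z)%N by rewrite zE muln_gt0 x0 (ltn_trans _ y2).
    have -> : (y * x.+1 = z + y)%N by rewrite mulnS zE addnC.
    rewrite -[(z * z * _)%N]mulnA ltn_pmul2l // mulnDr ltn_add2l zE.
    by case: y y2 {zE} => // y y2 /=; nia.
  exact: aux.
have [cf [[k0 ij0] /= cf0] rel] := exists_linear_relation F cnt.
pose r ij : {poly L} := \sum_(k < A) cf (k, ij) *: 'X^k.
exists r; first split.
- move=> ij; apply: (leq_trans (size_sum _ _ _)); apply/bigmax_leqP => k _.
  by apply: (leq_trans (size_scale_leq _ _)); rewrite size_polyXn.
- exists ij0; apply: contraNneq cf0 => r0.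
  have := congr1 (fun p : {poly L} => p`_k0) r0.
  rewrite coef0 coef_sum (bigD1 k0) //= coefZ coefXn eqxx mulr1 big1 ?addr0 => [->//|k kk].
  by rewrite coefZ coefXn (inj_eq val_inj) eq_sym (negPf kk) mulr0.
move=> l lM; apply/polyP => n; rewrite coef0.
have Er ij : (r ij)^`N(l) * W ij.1 ij.2
    = \sum_(k < A) cf (k, ij) *: (('X^k)^`N(l) * W ij.1 ij.2).
  rewrite /r linear_sum mulr_suml; apply: eq_bigr => k _.
  by rewrite linearZ /= scalerAl.
under eq_bigr do rewrite Er.
rewrite exchange_big pair_big coef_sum /=.
have [nB|Bn] := ltnP n Bd.
  rewrite -[RHS](rel (Ordinal lM, Ordinal nB)) /F /=.
  by apply: eq_bigr => -[k ij] _; rewrite coefZ.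
rewrite big1 // => -[k ij] _; rewrite coefZ [X in _ * X]nth_default ?mulr0 //.
apply: leq_trans Bn; apply: (leq_trans (size_polyMleq _ _)).
have := size_W ij.1 ij.2; have : (size ('X^k : {poly L})^`N(l) <= A)%N.
  rewrite nderivnXn -scaler_nat; apply: (leq_trans (size_scale_leq _ _)).
  by rewrite size_polyXn; apply: leq_ltn_trans (leq_subr _ _) (ltn_ord k).
rewrite /Bd => u v; apply: leq_trans (leq_add u v).
exact: leq_pred.
Qed.

(** The auxiliary polynomial [P] is nonzero, has size at most [M ^ 2 * q * (w + 2)] and vanishes to
    order [M] at each element of [s]. Comparing degrees leaves
    [M * q * (w + 2) = M ^ 2 + 2 * q * M]. *)
Lemma stepanov_bound (s : seq L) : uniq s ->
    {in s, forall x, [/\ x != 0, x ^+ (q ^ (mu.+1 + mu.+2)) = x &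
                        frobsum q a b (mu.+1 + mu.+2) x = c]} ->
  (size s <= q ^ mu.+1 * q ^ mu.+1 + 2 * q * q ^ mu.+1)%N.
Proof.
move=> uniq_s sol_s; rewrite -/M.
have [r [size_r [ij0 r0]] rel] := exists_coefs.
pose T ij := r ij * (G ij.1 ij.2 \Po 'X^M).
have sizeT ij : r ij != 0 -> size (T ij) = (A * (q.-1 + key ij) + size (r ij))%N.
  move=> rij; have [sG _] := size_lead_G ij.1 ij.2.
  have sC : size (G ij.1 ij.2 \Po 'X^M) = (A * (q.-1 + key ij)).+1.
    have := size_comp_poly (G ij.1 ij.2) 'X^M.
    rewrite size_polyXn sG /= -/(key ij) => E.
    rewrite -[LHS]prednK ?E /A; first by rewrite mulnAC.
    rewrite lt0n size_poly_eq0; apply: contraTneq M_gt0 => G0.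
    move: E; rewrite G0 size_poly0 /= => /esym/eqP; rewrite !muln_eq0.
    by rewrite (gtn_eqF M_gt0) orbF /= addn_eq0 -subn1 subn_eq0 leqNgt q_gt1.
  by rewrite size_mul // -?size_poly_eq0 sC // addnS addnC.
pose P := \sum_ij T ij.
have [im rim im_max] := @arg_maxnP _ ij0 (fun ij => r ij != 0) key r0.
(* Among the summands with nonzero coefficient, the one of largest [key] strictly exceeds the others
   in size. *)
have P_neq0 : P != 0.
  rewrite /P (bigD1 im) //= -size_poly_eq0 size_polyDl.
    by rewrite sizeT // addn_eq0 size_poly_eq0 negb_and rim orbT.
  rewrite sizeT //; apply: (leq_ltn_trans (size_sum _ _ _)).
  have s0 : (0 < size (r im))%N by rewrite lt0n size_poly_eq0.
  apply: (@leq_ltn_trans (A * (q.-1 + key im))); last by rewrite -[X in (X < _)%N]addn0 ltn_add2l.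
  apply/bigmax_leqP => ij ne; have [rij|rij] := eqVneq (r ij) 0.
    by rewrite /T rij mul0r size_poly0.
  rewrite sizeT //; apply: (@leq_trans (A * (q.-1 + key ij).+1)).
    by rewrite mulnS addnC leq_add2r.
  have le_key : (key ij <= key im)%N := im_max _ rij.
  rewrite leq_mul2l ltn_add2l ltn_neqAle le_key andbT (inj_eq key_inj) ne.
  by rewrite orbT.
have size_P : (size P <= A * (q * (w + 2)))%N.
  apply: (leq_trans (size_sum _ _ _)); apply/bigmax_leqP => ij _.
  have [rij|rij] := eqVneq (r ij) 0; first by rewrite /T rij mul0r size_poly0.
  rewrite sizeT //; apply: (@leq_trans (A * (q.-1 + key ij).+1)).
    by rewrite mulnS addnC leq_add2r.
  rewrite leq_mul2l; apply/orP; right; rewrite /key.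
  have aux (k i j n : nat) : (i < k -> j < n.+1 -> k.-1 + (i + k * j) < k * (n + 2))%N.
    move=> ik jn; have : (k * j <= k * n)%N by rewrite leq_mul2l -ltnS jn orbT.
    by rewrite mulnDr; lia.
  exact: aux.
(* Since [M] is a power of the characteristic, [('X - x) ^ M] equals ['X^M - x ^ M]. Modulo it each
   [G] composed with ['X^M] is the constant [G(x ^ M)], so only the [r ij] need to be
   differentiated. *)
have dvd_P x : x \in s -> ('X - x%:P) ^+ M %| P.
  move=> /sol_s sol; pose y := x ^+ M.
  have XM : ('X - x%:P) ^+ M = 'X^M - y%:P.
    have pM : [pchar {poly L}].-nat M.
      by rewrite pnatX (eq_pnat _ (pchar_poly L)) pcharq.
    by rewrite exprDn_pchar // exprNn_pchar // -polyC_exp.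
  have T_mod ij : ('X - x%:P) ^+ M %| T ij - (G ij.1 ij.2).[y] *: r ij.
    have /factor_theorem[h Eh] : root (G ij.1 ij.2 - (G ij.1 ij.2).[y]%:P) y.
      by rewrite rootE !hornerE subrr.
    have -> : T ij - (G ij.1 ij.2).[y] *: r ij = r ij * ((h * ('X - y%:P)) \Po 'X^M).
      by rewrite -Eh comp_polyB comp_polyC mulrBr [_ * _%:P]mulrC mul_polyC.
    rewrite comp_polyM comp_polyB comp_polyX comp_polyC XM.
    by rewrite mulrA dvdp_mull.
  have -> : P = \sum_ij (T ij - (G ij.1 ij.2).[y] *: r ij)
              + \sum_ij (G ij.1 ij.2).[y] *: r ij.
    by rewrite -big_split /=; apply: eq_bigr => ij _; rewrite subrK.
  apply: dvdp_add.
    apply: (big_ind (fun p => ('X - x%:P) ^+ M %| p)) => [|u v|ij _]; last exact: T_mod.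
      exact: dvdp0.
    exact: dvdp_add.
  apply: dvdp_XsubC_exp_nderivn => l lM.
  rewrite linear_sum horner_sum.
  have := congr1 (horner^~ x) (rel l lM); rewrite horner_sum horner0.
  move/(congr1 (fun z => (x ^+ M) ^+ (M * q.-1) / x ^+ (w * q.-1) * z)).
  rewrite mulr0 mulr_sumr => E; rewrite -[RHS]E; apply: eq_bigr => ij _.
  rewrite linearZ /= hornerZ /y (horner_GW _ _ sol) (hornerM (_^`N(l))).
  by rewrite -[LHS]mulrA; congr (_ * _); rewrite mulrC.
have dvd_prod : \prod_(x <- s) ('X - x%:P) ^+ M %| P.
  elim: s uniq_s dvd_P {sol_s} => [|x s IHs] /=; first by rewrite big_nil dvd1p.
  case/andP=> xs uniq_s dvd_P; rewrite big_cons Gauss_dvdp.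
    by rewrite dvd_P ?mem_head // IHs // => y ys; apply: dvd_P; rewrite inE ys orbT.
  apply: coprimep_expl; rewrite prodrXl; apply: coprimep_expr.
  by rewrite coprimep_sym coprimep_XsubC root_prod_XsubC.
have := dvdp_leq P_neq0 dvd_prod.
rewrite prodrXl; set p := \prod_(x <- s) _ => le_size.
have size_pM : size (p ^+ M) = (size s * M).+1.
  rewrite -[LHS]prednK; first by rewrite size_exp size_prod_XsubC.
  by rewrite lt0n size_poly_eq0 expf_neq0 // monic_neq0 // monic_prod_XsubC.
have lt_size := leq_trans le_size size_P; rewrite size_pM in lt_size.
have {}lt_size : (size s * M < M * q * (w + 2) * M)%N.
  apply: (leq_trans lt_size); rewrite /A; apply/eq_leq; ring.
move: lt_size; rewrite ltn_pmul2r // => /ltnW/leq_trans-> //.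
by rewrite mulnDr -mulnA -MqE; apply/eq_leq; ring.
Qed.

End Stepanov.

(** * The L-function of a Kloosterman sum *)

Section OrbitCount.
Variables (T : finType) (f : T -> T).
Hypothesis f_inj : injective f.

Lemma iter_order_dvdn (x : T) j : (iter j f x == x) = (order f x %| j)%N.
Proof.
have iter_mul k : iter (k * order f x) f x = x.
  by elim: k => // k IHk; rewrite mulSn iterD IHk iter_order.
apply/eqP/dvdnP => [jx|[k ->] //].
exists (j %/ order f x)%N; rewrite {1}(divn_eq j (order f x)).
suff -> : (j %% order f x = 0)%N by rewrite addn0.
have lt_m : (j %% order f x < order f x)%N by rewrite ltn_mod order_gt0.
rewrite -(findex_iter lt_m); apply/eqP; rewrite findex_eq0 eq_sym.
by move: jx; rewrite {1}(divn_eq j (order f x)) addnC iterD iter_mul => ->.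
Qed.

Lemma count_traject_order (x y : T) k :
  count_mem y (traject f x (k * order f x)) = (k * (y \in orbit f x))%N.
Proof.
elim: k => [|k IHk]; first by rewrite mul0n.
rewrite !mulSn trajectD count_cat iter_order // IHk.
by rewrite -/(orbit f x) count_uniq_mem ?orbit_uniq.
Qed.

Lemma card_multiples_leq (m v n : nat) : (0 < m)%N -> (m * v <= n)%N ->
  #|[set j : 'I_n.+1 | [&& 0 < j, m %| j & j %/ m <= v]%N]| = v.
Proof.
move=> m0 mvn; pose g (k : 'I_v) : 'I_n.+1 := inord (k.+1 * m).
have gE k : g k = (k.+1 * m)%N :> nat.
  rewrite inordK // ltnS; apply: leq_trans mvn.
  by rewrite mulnC leq_mul2l ltn_ord orbT.
have g_inj : injective g.
  move=> k l /(congr1 val); rewrite /= !gE => /eqP.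
  by rewrite eqn_pmul2r // eqSS => /eqP/val_inj.
rewrite -[RHS](card_ord v) -(card_imset _ g_inj); apply: eq_card => j.
rewrite inE; apply/idP/imsetP => [/and3P[j0 mj jv]|[k _ ->]].
  have d0 : (0 < j %/ m)%N by rewrite divn_gt0 // dvdn_leq.
  have dv : ((j %/ m).-1 < v)%N by rewrite prednK.
  exists (Ordinal dv) => //; apply: val_inj.
  by rewrite /= gE /= prednK // divnK.
by rewrite gE muln_gt0 m0 dvdn_mull // mulnK //= ltn_ord.
Qed.

(* For a root [x] of multiplicity [v], the traject of [x] of length [j] closes up
   and is contained in [rs] exactly for [j = k * order f x] with [k <= v]. *)
Lemma sum_closed_traject (rs : seq T) : perm_eq (map f rs) rs ->
  (\sum_(j < (size rs).+1) \sum_(x : T)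
    [&& 0 < j, iter j f x == x &
       [forall y, count_mem y (traject f x j) <= count_mem y rs]] = size rs)%N.
Proof.
move=> /permP f_rs.
have count_f y : count_mem (f y) rs = count_mem y rs.
  rewrite -f_rs count_map; apply: eq_count => z /=.
  by rewrite (inj_eq f_inj).
have count_iter x i : count_mem (iter i f x) rs = count_mem x rs.
  by elim: i => //= i IHi; rewrite count_f.
have count_orbit x y : y \in orbit f x -> count_mem y rs = count_mem x rs.
  by rewrite -fconnect_orbit => /iter_findex <-.
have sum_count : (\sum_(x : T) count_mem x rs = size rs)%N.
  elim: rs {f_rs count_f count_iter count_orbit} => [|y s IHs] /=.
    by rewrite big1.
  rewrite big_split /= IHs (bigD1 y) //= eqxx big1 // => x xy.
  by rewrite eq_sym (negPf xy).
rewrite exchange_big /= -[RHS]sum_count; apply: eq_bigr => x _.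
set v := count_mem x rs; set m := order f x.
have m0 : (0 < m)%N by exact: order_gt0.
(* The orbit of [x] contributes [m * v] entries to [rs], so stopping [j] at [size rs] loses no
   admissible multiple of [m]. *)
have mv : (m * v <= size rs)%N.
  rewrite -sum_count (bigID [in orbit f x]) /=.
  rewrite (eq_bigr (fun=> v)) => [|y]; last exact: count_orbit.
  rewrite sum_nat_const (card_uniqP (orbit_uniq f x)) size_orbit.
  exact: leq_addr.
rewrite -[RHS](card_multiples_leq m0 mv) -sum1dep_card [RHS]big_mkcond /=.
apply: eq_bigr => j _; rewrite iter_order_dvdn -/m.
case: (posnP j) => [->//|j0] /=; case: dvdnP => //= -[k jE].
have -> : [forall y, (count_mem y (traject f x j) <= count_mem y rs)%N]
    = (j %/ m <= v)%N; last by case: ifP.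
rewrite jE mulnK //; apply/forallP/idP => [/(_ x)|kv y].
  by rewrite count_traject_order -fconnect_orbit connect0 muln1.
rewrite count_traject_order; case: (boolP (y \in _)) => [/count_orbit->|_].
  by rewrite muln1.
by rewrite muln0.
Qed.
End OrbitCount.

Section RootSums.
Variable F : fieldType.
Implicit Types f g : {poly F}.

(* The factor ['X] makes [root_sum] vanish on constants, where [(size f).-2] would
   truncate to the constant coefficient. *)
Definition root_sum f : F := - (f * 'X)`_(size f).-1.
Definition root_inv_sum f : F := - f`_1 / f`_0.

Lemma root_sumM f g : f \is monic -> g \is monic ->
  root_sum (f * g) = root_sum f + root_sum g.
Proof.
have dec (h : {poly F}) : h \is monic ->
    exists2 r : {poly F}, (size r <= (size h).-1)%N & h = 'X^((size h).-1) + r.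
  move=> mh; exists (h - 'X^((size h).-1)); last by rewrite addrC subrK.
  apply/leq_sizeP => j; rewrite leq_eqVlt => /predU1P[<-|lt_j].
    by rewrite coefB coefXn eqxx -/(lead_coef h) (monicP mh) subrr.
  rewrite coefB coefXn gtn_eqF // subr0 nth_default //.
  exact: leq_trans (leqSpred _) lt_j.
move=> mf mg; rewrite /root_sum -opprD; congr (- _).
have f0 := monic_neq0 mf; have g0 := monic_neq0 mg.
rewrite size_mul //; set n := (size f).-1; set m := (size g).-1.
have -> : (size f + size g).-1.-1 = (n + m)%N.
  rewrite /n /m; have := f0; have := g0; rewrite -!size_poly_eq0; lia.
have [f' sf fE] := dec f mf; have [g' sg gE] := dec g mg.
rewrite fE gE -/n -/m; rewrite -/n in sf; rewrite -/m in sg.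
rewrite !(mulrDl, mulrDr) !coefD.
have cX k l (r : {poly F}) : (r * 'X^k * 'X)`_(l + k) = (r * 'X)`_l.
  by rewrite -mulrA ['X^k * 'X]mulrC mulrA coefMXn ltnNge leq_addl /= addnK.
have cXX k : ('X^k * 'X : {poly F})`_k = 0.
  by rewrite -exprSr coefXn ltn_eqF.
rewrite (cX m n 'X^n) cXX (cX m n f') ['X^n * g']mulrC (addnC n m) (cX n m g').
rewrite !cXX !add0r.
have -> : (f' * g' * 'X)`_(m + n) = 0.
  have [->|f'0] := eqVneq f' 0; first by rewrite !mul0r coef0.
  have [->|g'0] := eqVneq g' 0; first by rewrite mulr0 mul0r coef0.
  rewrite coefMX; case: eqP => // _; rewrite nth_default // size_mul //.
  by rewrite -!subn1 leq_sub2r // addnC leq_add.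
by rewrite addr0 addrC.
Qed.

Lemma root_inv_sumM f g : f`_0 != 0 -> g`_0 != 0 ->
  root_inv_sum (f * g) = root_inv_sum f + root_inv_sum g.
Proof.
move=> f0 g0; rewrite /root_inv_sum !coefM !big_ord_recl !big_ord0 /=.
by rewrite /bump /= !subn0 !addr0; field; rewrite f0 g0.
Qed.

Lemma root_sum_XsubC r : root_sum ('X - r%:P) = r.
Proof. by rewrite /root_sum size_XsubC /= coefMX /= coefB coefX coefC /= sub0r opprK. Qed.

Lemma root_inv_sum_XsubC r : root_inv_sum ('X - r%:P) = r^-1.
Proof.
by rewrite /root_inv_sum !coefB !coefX !coefC /= subr0 sub0r invrN mulrNN mul1r.
Qed.

Lemma root_sum_prod (s : seq F) : root_sum (\prod_(r <- s) ('X - r%:P)) = \sum_(r <- s) r.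
Proof.
elim: s => [|r s IHs]; first by rewrite !big_nil /root_sum size_poly1 mul1r coefX oppr0.
by rewrite !big_cons root_sumM ?monicXsubC ?monic_prod_XsubC // IHs root_sum_XsubC.
Qed.

Lemma root_inv_sum_prod (s : seq F) : 0 \notin s ->
  root_inv_sum (\prod_(r <- s) ('X - r%:P)) = \sum_(r <- s) r^-1.
Proof.
elim: s => [|r s IHs]; first by rewrite !big_nil /root_inv_sum !coef1 oppr0 mul0r.
rewrite inE negb_or => /andP[r0 s0]; rewrite !big_cons root_inv_sumM.
- by rewrite IHs // root_inv_sum_XsubC.
- by rewrite coefB coefX coefC sub0r oppr_eq0 eq_sym.
by rewrite -horner_coef0 -/(root _ 0) root_prod_XsubC.
Qed.

End RootSums.

Section RootSumsMap.
Variables (F F' : fieldType) (phi : {rmorphism F -> F'}).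

Lemma root_sum_map (f : {poly F}) : root_sum (map_poly phi f) = phi (root_sum f).
Proof.
by rewrite /root_sum size_map_poly !coefMX rmorphN coef_map; case: eqP; rewrite ?rmorph0.
Qed.

Lemma root_inv_sum_map (f : {poly F}) :
  root_inv_sum (map_poly phi f) = phi (root_inv_sum f).
Proof. by rewrite /root_inv_sum !coef_map rmorphM rmorphN fmorphV. Qed.

End RootSumsMap.

Lemma dvdp_prod_XsubC_count (F : fieldType) (s t : seq F) :
  (\prod_(x <- s) ('X - x%:P) %| \prod_(x <- t) ('X - x%:P)) <->
  (forall y, count_mem y s <= count_mem y t)%N.
Proof.
have nz (u : seq F) : \prod_(x <- u) ('X - x%:P) != 0.
  by rewrite monic_neq0 // monic_prod_XsubC.
split=> [st y|/count_subseqP[u /subseqP[m _ ->] su]].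
  rewrite -mu_prod_XsubC -[X in (_ <= X)%N]mu_prod_XsubC mup_geq //.
  by apply: dvdp_trans st; rewrite -mup_geq.
rewrite (perm_big _ su) /=; elim: t m {su} => [|x t IHt] [|[] m] //=;
  rewrite ?big_nil ?dvd1p // !big_cons.
  by rewrite dvdp_mul.
exact: dvdp_mull.
Qed.

Definition nontrivial_char (V : zmodType) (C : nzRingType) (psi : V -> C) :=
  [/\ psi 0 = 1, {morph psi : x y / x + y >-> x * y} & exists y, psi y != 1].

Definition kloosterman (K : finFieldType) (C : nzRingType) (psi : K -> C) (a b : K) : C :=
  \sum_(x | x != 0) psi (a * x + b / x).

Lemma sum_char_mul (K : finFieldType) (C : idomainType) (psi : K -> C) (c : K) :
  nontrivial_char psi -> \sum_y psi (c * y) = if c == 0 then #|K|%:R else 0.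
Proof.
case=> psi0 psiD [z psiz]; case: eqP => [->|/eqP c0].
  by under eq_bigr do rewrite mul0r psi0; rewrite sumr_const.
have shift : \sum_y psi (c * y) = psi z * \sum_y psi (c * y).
  rewrite {1}(reindex_inj (addrI (z / c))) mulr_sumr; apply: eq_bigr => y _.
  by rewrite mulrDr psiD [c * (z / c)]mulrC divfK.
apply/eqP; move/eqP: shift; rewrite -subr_eq0 -{1}[\sum_y _]mul1r -mulrBl mulf_eq0.
by rewrite subr_eq0 eq_sym (negPf psiz).
Qed.

Section LFunction.
Variables (K : finFieldType) (C : fieldType) (psi : K -> C) (a b : K).
Hypotheses (psiP : nontrivial_char psi) (a0 : a != 0) (b0 : b != 0).

Let psi0 : psi 0 = 1. Proof. by case: psiP. Qed.
Let psiD x y : psi (x + y) = psi x * psi y. Proof. by case: psiP. Qed.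

(** The completely multiplicative function on monic polynomials with value [psi (a * r + b / r)] at
    ['X - r], and [0] at ['X]. Its sums by degree are the coefficients of the L-function. *)
Definition Lam (f : {poly K}) : C :=
  if f`_0 == 0 then 0 else psi (a * root_sum f + b * root_inv_sum f).

(** Indexing by the lower coefficients turns sums over monic polynomials of degree [n] into sums
    over a finite type. *)
Definition mon n (v : 'rV[K]_n) : {poly K} := 'X^n + rVpoly v.

Definition monic_sum n : C := \sum_(v : 'rV[K]_n) Lam (mon v).

Lemma LamM (f g : {poly K}) : f \is monic -> g \is monic -> Lam (f * g) = Lam f * Lam g.
Proof.
move=> mf mg; rewrite /Lam coefM big_ord_recl big_ord0 addr0 /= subn0 mulf_eq0.
case: eqP => [_|/eqP f0]; first by rewrite mul0r.
case: eqP => [_|/eqP g0] /=; first by rewrite mulr0.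
by rewrite root_sumM // root_inv_sumM // -psiD; congr psi; ring.
Qed.

Lemma size_mon n (v : 'rV[K]_n) : size (mon v) = n.+1.
Proof. by rewrite size_polyDl size_polyXn // ltnS size_poly. Qed.

Lemma monic_mon n (v : 'rV[K]_n) : mon v \is monic.
Proof.
by rewrite monicE lead_coefDl ?lead_coefXn // size_polyXn ltnS size_poly.
Qed.

Lemma mon_poly_rV n (f : {poly K}) : f \is monic -> size f = n.+1 ->
  mon (poly_rV (f - 'X^n) : 'rV[K]_n) = f.
Proof.
move=> mf sf; rewrite /mon poly_rV_K; first by rewrite addrC subrK.
apply/leq_sizeP => j; rewrite leq_eqVlt => /predU1P[<-|lt_j].
  by rewrite coefB coefXn eqxx -[n]/(n.+1.-1) -sf -/(lead_coef f) (monicP mf) subrr.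
by rewrite coefB coefXn gtn_eqF // subr0 nth_default // sf.
Qed.

Lemma mon_inj n : injective (@mon n).
Proof. by move=> u v /addrI/(can_inj rVpolyK). Qed.

(** Multiplication by [h] is a bijection from the monic polynomials of degree [n - j] to the
    multiples of [h], and [Lam] is multiplicative. *)
Lemma monic_sum_dvdp n j (h : {poly K}) : h \is monic -> size h = j.+1 -> (j <= n)%N ->
  \sum_(v : 'rV[K]_n | h %| mon v) Lam (mon v) = Lam h * monic_sum (n - j).
Proof.
move=> mh sh jn; have h0 := monic_neq0 mh.
have sM (u : 'rV[K]_(n - j)) : size (h * mon u) = n.+1.
  by rewrite size_mul ?monic_neq0 ?monic_mon // sh size_mon addnS /= addSn subnKC.
pose g (u : 'rV[K]_(n - j)) : 'rV[K]_n := poly_rV (h * mon u - 'X^n).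
have gE u : mon (g u) = h * mon u by rewrite mon_poly_rV // monicMr ?monic_mon.
pose g' (v : 'rV[K]_n) : 'rV[K]_(n - j) := poly_rV (mon v %/ h - 'X^(n - j)).
rewrite (reindex_onto g g') /=; last first.
  move=> v /divpK hv; apply: mon_inj; rewrite gE /g' mulrC mon_poly_rV //.
    by move: (monic_mon v); rewrite -{1}hv monicMr.
  by rewrite size_divp // sh size_mon subSn.
rewrite /monic_sum mulr_sumr; apply: eq_big => [u|u _]; last first.
  by rewrite gE LamM ?monic_mon.
rewrite gE dvdp_mulr //=; apply/eqP; apply: mon_inj.
by rewrite /g' gE mulKp // mon_poly_rV ?monic_mon ?size_mon.
Qed.

Lemma monic_sum0 : monic_sum 0 = 1.
Proof.
rewrite /monic_sum (big_pred1 0) => [|v]; last by symmetry; apply/eqP/rowP; case.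
rewrite /mon linear0 addr0 /Lam coef1 oner_eq0 /root_sum /root_inv_sum size_poly1.
by rewrite mul1r coefX coef1 oppr0 mul0r !mulr0 addr0.
Qed.

Lemma monic_sum1 : monic_sum 1 = kloosterman psi a b.
Proof.
rewrite /monic_sum /kloosterman (reindex (fun x : K => (const_mx (- x) : 'rV[K]_1))) /=.
  rewrite [RHS]big_mkcond; apply: eq_bigr => x _.
  have -> : mon (const_mx (- x) : 'rV_1) = 'X - x%:P.
    apply/polyP => k; rewrite coefD coefXn coefB coefX coefC; congr (_ + _).
    rewrite coef_rVpoly; case: insubP => [i /= ik <-|]; first by rewrite ord1 mxE.
    by rewrite -leqNgt lt0n => /negPf->; rewrite oppr0.
  rewrite /Lam root_sum_XsubC root_inv_sum_XsubC coefB coefX coefC sub0r oppr_eq0.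
  by case: (x == 0).
exists (fun v : 'rV_1 => - v 0 0) => [x _|v _]; first by rewrite mxE opprK.
by apply/rowP => i; rewrite ord1 mxE opprK.
Qed.

Lemma Lam_mon n (v : 'rV[K]_n.+2) : Lam (mon v) =
  if v 0 0 == 0 then 0 else psi (- a * v 0 ord_max - b * v 0 1 / v 0 0).
Proof.
have c k (kn : (k < n.+2)%N) : (mon v)`_k = v 0 (Ordinal kn).
  by rewrite coefD coefXn ltn_eqF // add0r -coef_rVpoly_ord.
have c0 : (mon v)`_0 = v 0 0 by rewrite c; congr (v 0 _); apply: val_inj.
have c1 : (mon v)`_1 = v 0 1 by rewrite c; congr (v 0 _); apply: val_inj.
rewrite /Lam c0 /root_sum /root_inv_sum c1 c0 size_mon coefMX /= c.
case: eqP => // _; congr psi.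
by rewrite (_ : Ordinal _ = ord_max); [ring|apply: val_inj].
Qed.

(** In degree 2 the linear coefficient [y] governs both root sums, so the sum over [y] is that of
    [psi ((- a - b / x) * y)]. It survives only for the constant coefficient [x = - b / a], where it
    equals [q]. *)
Lemma monic_sum2 : monic_sum 2 = #|K|%:R.
Proof.
pose g (u : K * K) : 'rV[K]_2 := \row_i (if i == 0 then u.1 else u.2).
rewrite /monic_sum (reindex g) /=; last first.
  exists (fun v : 'rV_2 => (v 0 0, v 0 1)) => [[x y] _|v _]; first by rewrite !mxE.
  by apply/rowP => i; rewrite mxE; case: i => [[|[|]]] //= ?; congr (v 0 _); apply: val_inj.
rewrite -(pair_bigA _ (fun x y => Lam (mon (g (x, y))))) /=.
rewrite (bigD1 (- (b / a))) //= [X in _ + X]big1 => [|x xab].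
  under eq_bigr => y _.
    rewrite Lam_mon !mxE /= oppr_eq0 mulf_eq0 invr_eq0 (negPf a0) (negPf b0) /=.
    rewrite (_ : _ - _ = 0 * y); last by field; rewrite ?oppr_eq0 ?a0 ?b0.
    over.
  by rewrite sum_char_mul // eqxx addr0.
have [->|x0] := eqVneq x 0.
  by rewrite big1 // => y _; rewrite Lam_mon !mxE /= eqxx.
under eq_bigr => y _.
  rewrite Lam_mon !mxE /= (negPf x0) (_ : _ - _ = (- a - b / x) * y); last by field.
  over.
rewrite sum_char_mul // ifN // -opprD oppr_eq0; apply: contra xab => ab0.
by apply/eqP; move: ab0; rewrite addr_eq0 => /eqP->; field; rewrite ?oppr_eq0 ?x0 ?b0.
Qed.

(** From degree 3 on, the subleading coefficient is distinct from the two lowest ones; translating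
    it multiplies the sum by a character value other than 1. *)
Lemma monic_sum_ge3 n : monic_sum n.+3 = 0.
Proof.
have [y psiy] : exists y, psi (- a * y) != 1.
  case: psiP => _ _ [y yP]; exists (- (y / a)).
  by rewrite mulrNN mulrC divfK.
pose d : 'rV[K]_n.+3 := y *: delta_mx 0 ord_max.
have shift : monic_sum n.+3 = psi (- a * y) * monic_sum n.+3.
  rewrite {1}/monic_sum (reindex_inj (addrI d)) /monic_sum mulr_sumr.
  apply: eq_bigr => v _; rewrite !Lam_mon /d !mxE /= ?eqxx !mulr0 !add0r mulr1.
  case: eqP => _; first by rewrite mulr0.
  by rewrite -psiD; congr psi; rewrite mulrDr addrA.
apply/eqP; move/eqP: shift; rewrite -subr_eq0 -{1}[monic_sum _]mul1r -mulrBl mulf_eq0.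
by rewrite subr_eq0 eq_sym (negPf psiy).
Qed.

End LFunction.

(** The condition on [q] is an argument so that the ring morphism structure can be attached to the
    map itself. *)
Definition powchar (R : comNzRingType) (q : nat) of [pchar R].-nat q := fun x : R => x ^+ q.

Section PowChar.
Variables (R : comNzRingType) (q : nat) (pcharq : [pchar R].-nat q).
Let f := powchar pcharq.

Fact powchar_is_zmod_morphism : zmod_morphism f.
Proof. by move=> x y; rewrite /f /powchar exprDn_pchar // exprNn_pchar. Qed.

Fact powchar_is_monoid_morphism : monoid_morphism f.
Proof. by split=> [|x y]; rewrite /f /powchar ?expr1n ?exprMn. Qed.

HB.instance Definition _ := GRing.isZmodMorphism.Build R R f powchar_is_zmod_morphism.
HB.instance Definition _ := GRing.isMonoidMorphism.Build R R f powchar_is_monoid_morphism.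
End PowChar.

(** * Descent of Frobenius-stable polynomials from [L] to [K] *)

Section Descent.
Variables (K L : finFieldType) (phi : {rmorphism K -> L}).
Let q := #|K|.
Let fr (x : L) := x ^+ q.

Lemma pchar_card_subfield : [pchar L].-nat q.
Proof.
have [p _ pK] := finPcharP K.
have pL : p \in [pchar L] by rewrite (rmorph_pchar phi).
rewrite /q (card_pprimeChar pK) pnatX; apply/orP; left.
by rewrite pnatE ?(pcharf_prime pK).
Qed.

Lemma powchar_inj : injective fr.
Proof. exact: (fmorph_inj (powchar pchar_card_subfield)). Qed.

Lemma iter_pow_card j x : iter j fr x = x ^+ (q ^ j).
Proof. by elim: j => //= j ->; rewrite /fr -exprM expnSr. Qed.

Lemma frobenius_fixed_image y : y ^+ q = y -> exists x, y = phi x.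
Proof.
have q1 : (1 < q)%N by exact: finNzRing_gt1.
pose p : {poly L} := 'X^q - 'X.
have sp : size p = q.+1 by rewrite size_polyDl ?size_polyXn // size_polyN size_polyX.
have p0 : p != 0 by rewrite -size_poly_eq0 sp.
move=> yq; suff /existsP[x /eqP->] : [exists x, y == phi x] by exists x.
apply: contraT => /existsPn ny.
have : (size (y :: [seq phi x | x : K]) < size p)%N.
  apply: max_poly_roots => //.
    apply/allP => z; rewrite inE => /predU1P[->|/mapP[x _ ->]].
      by rewrite rootE !hornerE yq subrr.
    by rewrite rootE !hornerE -rmorphXn expf_card subrr.
  rewrite /= map_inj_uniq ?enum_uniq ?andbT; last exact: fmorph_inj.
  by apply/mapP => -[x _ yx]; have := ny x; rewrite yx eqxx.
by rewrite sp /= size_map -cardE ltnn.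
Qed.

Definition descend (y : L) : K := odflt 0 [pick x | phi x == y].

Lemma descendK : cancel phi descend.
Proof.
move=> x; rewrite /descend; case: pickP => [z /eqP/fmorph_inj //|/(_ x)].
by rewrite eqxx.
Qed.

Lemma descend_fixed y : y ^+ q = y -> phi (descend y) = y.
Proof. by move=> /frobenius_fixed_image[x ->]; rewrite descendK. Qed.

Definition charpoly_orbit (x : L) j : {poly L} := \prod_(y <- traject fr x j) ('X - y%:P).

Lemma perm_map_traject x j : iter j fr x = x ->
  perm_eq (map fr (traject fr x j)) (traject fr x j).
Proof.
move=> jx; have -> : map fr (traject fr x j) = traject fr (fr x) j.
  by elim: j x {jx} => //= j IHj x; rewrite IHj.
rewrite -(perm_cons x) -trajectS trajectSr jx.
by rewrite perm_sym -perm_rcons.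
Qed.

(** Frobenius permutes a closed trajectory, hence fixes the coefficients of the product, and its
    fixed points are the image of [K]. *)
Lemma charpoly_orbit_descend x j : iter j fr x = x ->
  map_poly phi (map_poly descend (charpoly_orbit x j)) = charpoly_orbit x j.
Proof.
move=> jx; have d0 : descend 0 = 0 by rewrite -(rmorph0 phi) descendK.
apply/polyP => k; rewrite coef_map /= coef_map_id0 // descend_fixed //; set c := charpoly_orbit x j.
have : map_poly (powchar pchar_card_subfield) c = c.
  rewrite /c /charpoly_orbit rmorph_prod -[RHS](perm_big _ (perm_map_traject jx)).
  rewrite big_map; apply: eq_bigr => y _.
  by rewrite rmorphB /= map_polyX map_polyC.
by move/(congr1 (fun p : {poly L} => p`_k)); rewrite coef_map.
Qed.

(** [sum_closed_traject] applied to the roots of [f], with inclusion of multisets read as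
    divisibility. This count produces the weight [n] in Newton's identity. *)
Lemma sum_orbit_dvdp (f : {poly K}) n : f \is monic -> size f = n.+1 ->
    (exists rs, map_poly phi f = \prod_(r <- rs) ('X - r%:P)) ->
  (\sum_(j < n.+1) \sum_(x : L)
    [&& 0 < j, iter j fr x == x & (map_poly descend (charpoly_orbit x j) %| f)%R] = n)%N.
Proof.
move=> mf sf [rs fE].
have size_rs : size rs = n.
  by have := congr1 (fun p : {poly L} => size p) fE; rewrite size_map_poly sf size_prod_XsubC => -[].
have fr_rs : perm_eq (map fr rs) rs.
  apply: prod_XsubC_eq; rewrite -fE big_map.
  have : map_poly (powchar pchar_card_subfield) (map_poly phi f) = map_poly phi f.
    rewrite -map_poly_comp; apply: eq_map_poly => x.
    by rewrite /= /powchar -rmorphXn expf_card.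
  rewrite {1}fE rmorph_prod => <-; apply: eq_bigr => y _.
  by rewrite rmorphB /= map_polyX map_polyC.
rewrite -[RHS]size_rs -(sum_closed_traject powchar_inj fr_rs) size_rs.
apply: eq_bigr => j _; apply: eq_bigr => x _.
case: (0 < j)%N => //=; case: eqP => //= jx.
rewrite -(dvdp_map phi) charpoly_orbit_descend // fE.
by congr nat_of_bool; apply/idP/forallP => /dvdp_prod_XsubC_count.
Qed.

End Descent.

Section Newton.
Variables (K : finFieldType) (C : fieldType) (psi : K -> C) (a b : K).
Hypotheses (psiP : nontrivial_char psi).
Variables (L : finFieldType) (phi : {rmorphism K -> L}).
Let q := #|K|.

(** When [L] contains the field of [q ^ j] elements, this is the Kloosterman sum over that field, by
    [Lam_charpoly_orbit]. The form through [Lam] is the one suited to Newton's identity. *)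
Definition orbit_sum j : C :=
  \sum_(x : L | x ^+ (q ^ j) == x) Lam psi a b (map_poly (descend phi) (charpoly_orbit K x j)).

(** Coefficient form of the logarithmic derivative of the L-function, obtained without power series:
    each [f] is counted [n] times through the pairs [(j, x)] whose orbit polynomial divides it, and
    the sums are exchanged. *)
Lemma newton_identity n :
    (forall f : {poly K}, f \is monic -> size f = n.+1 ->
       exists rs, map_poly phi f = \prod_(r <- rs) ('X - r%:P)) ->
  n%:R * monic_sum psi a b n =
    \sum_(j < n.+1 | (0 < j)%N) orbit_sum j * monic_sum psi a b (n - j).
Proof.
move=> split_n; rewrite /monic_sum mulr_sumr.
under eq_bigr => v _.
  rewrite -{1}(sum_orbit_dvdp (monic_mon v) (size_mon v) (split_n _ (monic_mon v) (size_mon v))).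
  rewrite natr_sum mulr_suml.
  under eq_bigr do rewrite natr_sum mulr_suml.
  over.
rewrite exchange_big [RHS]big_mkcond /=; apply: eq_bigr => j _.
rewrite exchange_big /=; case: (posnP j) => [->|j0].
  by rewrite big1 // => x _; rewrite big1 // => v _; rewrite mul0r.
rewrite /orbit_sum mulr_suml [RHS]big_mkcond; apply: eq_bigr => x _.
rewrite iter_pow_card -/q; case: eqP => [jx|_]; last first.
  by rewrite big1 // => v _; rewrite mul0r.
have jx' : iter j (fun x => x ^+ q) x = x by rewrite iter_pow_card.
have cE := charpoly_orbit_descend phi jx'; set h := map_poly (descend phi) _ in cE *.
have mh : h \is monic by rewrite -(map_monic phi) cE monic_prod_XsubC.
have sh : size h = j.+1.
  by rewrite -(size_map_poly phi) cE size_prod_XsubC size_traject.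
have jn : (j <= n)%N by rewrite -ltnS.
rewrite -/(monic_sum psi a b (n - j)) -(monic_sum_dvdp a b psiP mh sh jn) [RHS]big_mkcond.
by apply: eq_bigr => v _; case: (h %| _); rewrite ?mul1r ?mul0r.
Qed.

Let h x j : {poly K} := map_poly (descend phi) (charpoly_orbit K x j).

Let mem0_traject (x : L) j : (0 < j)%N -> (0 \in traject (fun y => y ^+ q) x j) = (x == 0).
Proof.
move=> j0; apply/idP/eqP => [/trajectP[i _]|->]; last first.
  by case: j j0 => //= j _; rewrite inE eqxx.
by rewrite iter_pow_card => /esym/eqP; rewrite expf_eq0 => /andP[_ /eqP].
Qed.

(** The trajectory lists the conjugates of [x], so the root sum and the inverse root sum of its
    polynomial are the traces of [x] and of its inverse. *)
Lemma frobsum_charpoly_orbit x j : x ^+ (q ^ j) = x -> (0 < j)%N -> x != 0 ->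
  frobsum q (phi a) (phi b) j x = phi (a * root_sum (h x j) + b * root_inv_sum (h x j)).
Proof.
move=> jx j0 x0; have jx' : iter j (fun x => x ^+ q) x = x by rewrite iter_pow_card.
have cE : map_poly phi (h x j) = _ := charpoly_orbit_descend phi jx'.
rewrite rmorphD (rmorphM phi a) (rmorphM phi b) -root_sum_map -root_inv_sum_map cE.
rewrite root_sum_prod root_inv_sum_prod ?mem0_traject // !mulr_sumr -big_split /=.
rewrite /frobsum -(big_mkord xpredT (fun i => phi a * x ^+ (q ^ i) + phi b * x^-1 ^+ (q ^ i))).
rewrite (big_nth x) size_traject.
by apply: eq_big_nat => i /andP[_ ij]; rewrite nth_traject // iter_pow_card exprVn.
Qed.

Lemma frobsum_descend x j : x ^+ (q ^ j) = x -> (0 < j)%N -> x != 0 ->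
  phi (descend phi (frobsum q (phi a) (phi b) j x)) = frobsum q (phi a) (phi b) j x.
Proof. by move=> jx j0 x0; rewrite frobsum_charpoly_orbit // descendK. Qed.

Lemma Lam_charpoly_orbit x j : x ^+ (q ^ j) = x -> (0 < j)%N ->
  Lam psi a b (map_poly (descend phi) (charpoly_orbit K x j)) =
  if x == 0 then 0 else psi (descend phi (frobsum q (phi a) (phi b) j x)).
Proof.
move=> jx j0; have jx' : iter j (fun x => x ^+ q) x = x by rewrite iter_pow_card.
have cE : map_poly phi (h x j) = _ := charpoly_orbit_descend phi jx'.
have h0 : ((h x j)`_0 == 0) = (x == 0).
  rewrite -(fmorph_eq0 phi) -coef_map cE -horner_coef0 -/(root _ 0) root_prod_XsubC.
  exact: mem0_traject.
rewrite /Lam h0; case: eqP => // /eqP x0; congr psi.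
by rewrite frobsum_charpoly_orbit // descendK.
Qed.

End Newton.

(** * The Weil bound for Kloosterman sums *)

(** The splitting field of the product of all nonzero polynomials of size at most [N]; a single [L]
    then serves every degree in the recursion. *)
Lemma exists_splitting_extension (K : finFieldType) (N : nat) :
  exists (L : finFieldType) (phi : {rmorphism K -> L}), forall f : {poly K},
    f \is monic -> (size f <= N)%N ->
    exists rs, map_poly phi f = \prod_(r <- rs) ('X - r%:P).
Proof.
pose p : {poly K} := \prod_(v : 'rV[K]_N | rVpoly v != 0) rVpoly v.
have /FinSplittingFieldFor[L [rs pE _]] : p != 0 by apply/prodf_neq0.
exists (FinFieldExtType L), (in_alg L : {rmorphism K -> L}) => f mf sf.
have fp : f %| p.
  rewrite /p (bigD1 (poly_rV f)) /= ?poly_rV_K ?monic_neq0 //.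
  exact: dvdp_mulr.
have : map_poly (in_alg L) f %| \prod_(z <- rs) ('X - z%:P).
  by rewrite -(eqp_dvdr _ pE) dvdp_map.
case/dvdp_prod_XsubC=> m fE; exists (mask m rs); apply/eqP.
by rewrite -eqp_monic // ?monic_prod_XsubC ?map_monic.
Qed.

(** * Modulus on [R[i]] and unitarity of characters *)

Section ComplexModulus.
Variable R : rcfType.
Implicit Types z w : R[i].

Lemma normcR (x : R) : normc (x%:C)%C = `|x|.
Proof. by rewrite /= expr0n addr0 sqrtr_sqr. Qed.

Lemma normc_ge0 z : 0 <= normc z.
Proof. by case: z => x y; apply: sqrtr_ge0. Qed.

Lemma normc_nat n : normc (n%:R : R[i]) = n%:R.
Proof.
have -> : (n%:R : R[i]) = ((n%:R : R)%:C)%C by rewrite rmorph_nat.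
by rewrite normcR ger0_norm.
Qed.

Lemma normcX z n : normc (z ^+ n) = normc z ^+ n.
Proof. by elim: n => [|n IHn]; rewrite ?expr0 ?normc1 // !exprS normcM IHn. Qed.

Lemma sqr_normcC z : ((normc z ^+ 2)%:C)%C = z * conjc z.
Proof. by rewrite -sqr_normc rmorphXn. Qed.

Lemma le_normc_sum (I : Type) (r : seq I) (P : pred I) (F : I -> R[i]) :
  normc (\sum_(i <- r | P i) F i) <= \sum_(i <- r | P i) normc (F i).
Proof.
elim/big_rec2: _ => [|i y z _ le_zy]; first by rewrite normc0.
by apply: le_trans (le_normcD _ _) _; rewrite lerD2l.
Qed.

Lemma normc_conj z : normc (conjc z) = normc z.
Proof. by case: z => x y /=; rewrite sqrrN. Qed.

Lemma le_normcB z w : normc z - normc w <= normc (z + w).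
Proof.
rewrite lerBlDr -[X in normc X <= _](addrK w); apply: le_trans (le_normcD _ _) _.
by rewrite (normcN w).
Qed.

End ComplexModulus.

Section UnitaryChar.
Variables (R : rcfType) (K : finFieldType) (psi : K -> R[i]).
Hypothesis psiP : nontrivial_char psi.

Lemma normc_char x : normc (psi x) = 1.
Proof.
case: psiP => psi0 psiD _; have [p p_pr pK] := finPcharP K.
have psiMn n : psi (x *+ n) = psi x ^+ n.
  by elim: n => [|n IHn]; rewrite ?mulr0n // mulrS psiD IHn exprS.
have := psiMn p; rewrite (mulrn_pchar pK) psi0 => /(congr1 (@normc R)).
rewrite normc1 normcX => /esym/eqP; rewrite pexpr_eq1 ?normc_ge0 ?prime_gt0 //.
by move/eqP.
Qed.

Lemma conjc_char x : conjc (psi x) = psi (- x).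
Proof.
case: psiP => psi0 psiD _; have pN : psi x * psi (- x) = 1 by rewrite -psiD subrr.
have px0 : psi x != 0 by apply: contra_eq_neq pN => ->; rewrite mul0r eq_sym oner_eq0.
by apply: (mulfI px0); rewrite pN -sqr_normcC normc_char expr1n.
Qed.

End UnitaryChar.

Section KloostermanBound.
Variables (R : rcfType) (K : finFieldType) (psi : K -> R[i]) (a b : K).
Hypotheses (psiP : nontrivial_char psi) (a0 : a != 0) (b0 : b != 0).
Hypothesis oddK : odd #|K|.
Let q := #|K|.

Let q_gt2 : (2 < q)%N.
Proof. by move: oddK (finNzRing_gt1 K); rewrite /q; case: #|K| => [|[|[]]]. Qed.

Section Extension.
Variables (L : finFieldType) (phi : {rmorphism K -> L}) (mu : nat).
Let n := (mu.+1 + mu.+2)%N.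
Let Q := (q ^ n)%N.
Let M := (q ^ mu.+1)%N.
Hypothesis split_Q : exists rs, map_poly phi ('X^Q - 'X) = \prod_(r <- rs) ('X - r%:P).

Let Q_gt1 : (1 < Q)%N.
Proof. by rewrite -(exp1n n) ltn_exp2r ?(ltn_trans _ q_gt2). Qed.

(** The derivative of ['X^Q - 'X] is [-1], so its [Q] roots in [L] are distinct. *)
Lemma card_fixed_points : (Q <= #|[set x : L | x ^+ Q == x]|)%N.
Proof.
have [rs] := split_Q; rewrite rmorphB rmorphXn /= map_polyX => rsE.
have size_rs : size rs = Q.
  have := congr1 (fun p : {poly L} => size p) rsE; rewrite size_prod_XsubC.
  by rewrite size_polyDl ?size_polyXn ?size_polyN ?size_polyX // => -[].
have uniq_rs : uniq rs.
  rewrite -separable_prod_XsubC -rsE unlock derivB derivXn derivX.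
  have Q0 : Q%:R = 0 :> L.
    have [p _ pL] := finPcharP L.
    have : [pchar L].-nat Q by rewrite pnatX (pchar_card_subfield phi).
    rewrite (eq_pnat _ (pcharf_eq pL)) => /p_natP[[|k] Qk].
      by move: Q_gt1; rewrite Qk.
    by rewrite Qk expnS natrM (pcharf0 pL) mul0r.
  rewrite -mulr_natr -polyC_natr Q0 mulr0.
  by rewrite sub0r -[X in coprimep _ X]scaleN1r coprimepZr ?oppr_eq0 ?oner_eq0 // coprimep1.
rewrite -[X in (X <= _)%N]size_rs -(card_uniqP uniq_rs); apply: subset_leq_card.
apply/subsetP => x xrs; rewrite inE -subr_eq0.
have : root ('X^Q - 'X) x by rewrite rsE root_prod_XsubC.
by rewrite rootE !hornerE.
Qed.

Let g (x : L) : K := descend phi (frobsum q (phi a) (phi b) n x).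
Let N (c : K) := #|[set x : L | [&& x != 0, x ^+ Q == x & g x == c]]|.

Let N_le c : (N c <= M * M + 2 * q * M)%N.
Proof.
rewrite /N cardE; apply: (@stepanov_bound L q mu (phi a) (phi b) (phi c)) => //.
- exact: pchar_card_subfield phi.
- by rewrite fmorph_eq0.
- exact: enum_uniq.
move=> x; rewrite mem_enum inE => /and3P[x0 /eqP xQ /eqP <-]; split=> //.
by rewrite /g frobsum_descend.
Qed.

Let sum_N : (Q.-1 <= \sum_c N c)%N.
Proof.
have -> : (\sum_c N c)%N = #|[set x : L | (x != 0) && (x ^+ Q == x)]|.
  rewrite -sum1dep_card (partition_big g xpredT) //=; apply: eq_bigr => c _.
  by rewrite /N -sum1dep_card; apply: eq_bigl => x; rewrite andbA.
have := card_fixed_points; rewrite (cardsD1 (0 : L)) inE expr0n.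
rewrite gtn_eqF ?(ltnW Q_gt1) // eqxx add1n -(ltn_predK Q_gt1) ltnS => /leq_trans-> //.
by apply: subset_leq_card; apply/subsetP => x; rewrite !inE.
Qed.

(** Let [B] be the common upper bound for the fibres [N c]. As [psi] sums to zero, [N c] may be
    replaced by the deficit [B - N c >= 0]. The deficits total at most
    [q * B - (Q - 1) = 2 * q ^ 2 * M + 1]. *)
Lemma normc_orbit_sum_le :
  normc (orbit_sum psi a b phi n) <= (2 * q ^ 2 * M + 1)%:R.
Proof.
have -> : orbit_sum psi a b phi n = \sum_c (N c)%:R * psi c.
  rewrite /orbit_sum -/q -/Q.
  transitivity (\sum_(x : L | (x != 0) && (x ^+ Q == x)) psi (g x)).
    rewrite [LHS]big_mkcond [RHS]big_mkcond; apply: eq_bigr => x _.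
    case: eqP => [xQ|_]; last by rewrite andbF.
    by rewrite Lam_charpoly_orbit // andbT; case: eqP.
  rewrite (partition_big g xpredT) //=; apply: eq_bigr => c _.
  rewrite (eq_bigr (fun=> psi c)) => [|x /andP[_ /eqP->] //].
  rewrite sumr_const mulr_natl /N cardsE; congr (_ *+ _); apply: eq_card => x.
  by rewrite -!topredE /= andbA.
pose B := (M * M + 2 * q * M)%N.
have -> : \sum_c (N c)%:R * psi c = \sum_c - ((B - N c)%:R * psi c).
  have sum_psi : \sum_c psi c = 0.
    rewrite -(eq_bigr _ (fun c _ => congr1 psi (mul1r c))) (sum_char_mul 1 psiP).
    by rewrite oner_eq0.
  rewrite -[RHS]addr0 -[X in _ + X](mulr0 B%:R) -[X in _ * X]sum_psi.
  rewrite mulr_sumr -big_split /=; apply: eq_bigr => c _.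
  by rewrite natrB ?N_le //; ring.
apply: le_trans (le_normc_sum _ _ _) _.
rewrite (eq_bigr (fun c => (B - N c)%:R)) => [|c _]; last first.
  by rewrite (normcN _) normcM normc_char // mulr1 normc_nat.
rewrite -natr_sum ler_nat.
have EB : (\sum_(c : K) (B - N c) + \sum_c N c = q * B)%N.
  rewrite -big_split /= (eq_bigr (fun=> B)) => [|c _]; last by rewrite subnK ?N_le.
  by rewrite sum_nat_const.
have QE : Q = (q * (M * M))%N by rewrite /Q /n addnS expnS expnD.
have := sum_N; move: EB; rewrite /B mulnDr QE; have := ltnW Q_gt1; rewrite QE.
have -> : (q * (2 * q * M) = 2 * q ^ 2 * M)%N by ring.
have aux (x y t u : nat) : (0 < x -> t + u = x + y -> x.-1 <= u -> t <= y + 1)%N by lia.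
exact: aux.
Qed.

End Extension.

Lemma kloosterman_bound :
  normc (kloosterman psi a b) <= 3 * Num.sqrt (q%:R : R).
Proof.
set Kl := kloosterman psi a b; set s : R := Num.sqrt _.
have q_ge1 : 1 <= q%:R :> R by rewrite ler1n (ltnW (ltnW q_gt2)).
have s2 : s ^+ 2 = q%:R by rewrite sqr_sqrtr ?ler0n.
have s_ge1 : 1 <= s by rewrite -sqrtr1 ler_wsqrtr.
rewrite leNgt; apply/negP => ltK.
(* Large enough for [2 ^ n] to reach [3 * q ^ 2 + 1], which beats the constant in the upper
   bound. *)
pose mu := (q ^ 2)%N; pose n := (mu.+1 + mu.+2)%N.
have [L [phi split_L]] := exists_splitting_extension K (q ^ n).+1.
pose S := orbit_sum psi a b phi.
have newton m : (m <= n)%N -> m%:R * monic_sum psi a b m =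
    \sum_(j < m.+1 | (0 < j)%N) S j * monic_sum psi a b (m - j).
  move=> mn; apply: newton_identity => // f mf sf; apply: split_L => //.
  rewrite sf ltnS (leq_trans mn) // ltnW // ltn_expl //.
  exact: ltn_trans q_gt2.
have S1 : S 1 = Kl.
  have := newton 1%N (isT : (1 <= n)%N); rewrite mul1r monic_sum1 // -/Kl => ->.
  by rewrite big_mkcond !big_ord_recl big_ord0 /= add0r addr0 monic_sum0 ?mulr1.
(* The L-function has degree 2, so at most three terms of Newton's identity survive. For [m = 0] the
   index [j = 0] is excluded and the left side is [2 * q]. *)
have recS m : (m.+2 <= n)%N -> S m.+2 =
    (if m == 0 then 2 * q%:R else - (S m * q%:R)) - S m.+1 * Kl.
  move=> mn; have := newton m.+2 mn; rewrite big_mkcond !big_ord_recr /=.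
  rewrite big1 ?add0r => [|j _]; last first.
    case: ifP => // _.
    have -> : (m.+2 - j = (m - j.+1).+3)%N by have := ltn_ord j; lia.
    by rewrite monic_sum_ge3 ?mulr0.
  rewrite subnn subSnn monic_sum0 // mulr1 monic_sum1 // -/Kl.
  rewrite (_ : (m.+2 - m = 2)%N) ?monic_sum2 //; last by lia.
  case: m mn => [|m] mn /=; first by rewrite monic_sum2 // add0r => ->; ring.
  by rewrite monic_sum_ge3 // mulr0 => E; apply/eqP; rewrite -subr_eq0 [X in _ == X]E; apply/eqP; ring.
pose u j := normc (S j).
have u_ge0 j : 0 <= u j by exact: normc_ge0.
(* If a ratio of consecutive terms is at least [2 s], the next one is at least
   [3 s - s ^ 2 / (2 s)], again above [2 s]. *)
have step m : (m.+2 <= n)%N -> 2 * s * u m.+1 <= u m.+2.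
  elim: m => [|m IHm] mn.
    have : u 1%N ^+ 2 - 2 * s ^+ 2 <= u 2%N.
      rewrite /u (recS _ mn) /= S1 s2 -normcX -expr2 -(normcN (Kl ^+ 2)).
      rewrite (_ : 2 * q%:R = normc ((2 * q)%:R : R[i])); last by rewrite normc_nat natrM.
      by rewrite natrM [2 * _ - _]addrC; apply: le_normcB.
    by rewrite /u S1 -/(u _); nra.
  have IH := IHm (ltnW mn).
  have : normc Kl * u m.+2 - s ^+ 2 * u m.+1 <= u m.+3.
    rewrite [u m.+3]/u (recS _ mn) /= s2 [_ - S m.+2 * Kl]addrC.
    rewrite (_ : q%:R * u m.+1 = normc (- (S m.+1 * q%:R))); last first.
      by rewrite (normcN _) normcM normc_nat mulrC.
    rewrite mulrC -normcM -(normcN (S m.+2 * Kl)); exact: le_normcB.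
  have := u_ge0 m.+1; have := u_ge0 m.+2; nra.
have lower j : (0 < j <= n)%N -> (2 * s) ^+ j <= u j.
  elim: j => // -[|j] IHj /andP[_ jn]; first by rewrite expr1 /u S1; lra.
  rewrite exprS; apply: le_trans (step _ jn); apply: ler_wpM2l; first by lra.
  by apply: IHj; rewrite /= ltnW.
have upper : u n <= (2 * q ^ 2 * q ^ mu.+1 + 1)%:R.
  have Q_gt1 : (1 < q ^ n)%N by rewrite -(exp1n n) ltn_exp2r ?(ltn_trans _ q_gt2).
  have lt_size : (size (- 'X : {poly K}) < size ('X^(q ^ n) : {poly K}))%N.
    by rewrite size_polyN size_polyX size_polyXn.
  apply: normc_orbit_sum_le; apply: split_L.
    by rewrite monicE lead_coefDl ?lead_coefXn.
  by rewrite size_polyDl // size_polyXn.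
have := le_trans (lower n (leqnn n : 0 < n <= n)%N) upper.
(* As [n = 2 * mu.+1 + 1], the power [s ^ n] is [s * q ^ mu.+1], comparable with the upper bound;
   the factor [2 ^ n] decides. *)
have -> : (2 * s) ^+ n = (2 ^ n)%:R * (s * (q ^ mu.+1)%:R).
  rewrite exprMn natrX; congr (_ * _).
  have -> : n = (2 * mu.+1).+1 by rewrite /n; lia.
  by rewrite exprS exprM s2 natrX.
rewrite natrD (natrM _ _ (q ^ mu.+1)) (natrM _ 2); apply/negP; rewrite -ltNge.
have big_n : (3 * q ^ 2)%:R + 1 <= (2 ^ n)%:R :> R.
  rewrite -(natrD _ _ 1) ler_nat addn1.
  have := ltn_expl mu (isT : (1 < 2)%N).
  rewrite /n /mu addSn addnS addnS !expnS expnD; move: (q ^ 2)%N (2 ^ _)%N; nia.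
have M_ge1 : 1 <= (q ^ mu.+1)%:R :> R by rewrite ler1n expn_gt0 (ltnW (ltnW q_gt2)).
have q2_ge1 : 1 <= (q ^ 2)%:R :> R by rewrite ler1n expn_gt0 (ltnW (ltnW q_gt2)).
rewrite natrM in big_n.
move: (q ^ mu.+1)%:R (q ^ 2)%:R (2 ^ n)%:R M_ge1 q2_ge1 big_n => m v x m1 v1 vx.
have : x * m <= x * (s * m) by rewrite mulrA ler_wpM2r ?ler_peMr //; lra.
have : (3 * v + 1) * m <= x * m by rewrite ler_wpM2r //; lra.
have : 1 <= v * m by rewrite -[leLHS]mulr1 ler_pM.
lra.
Qed.

End KloostermanBound.

(** * Gauss sums and Fourier analysis *)

(** A primitive [p]-th root of unity is a root of [1 + X + ... + X^(p-1)], since order 1 would force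
    [p = 0] in [C]. It is raised to a coordinate over ['F_p] that does not vanish at [1], in place
    of the trace. *)
Lemma exists_nontrivial_char (K : finFieldType) (C : closedFieldType) :
  [pchar C] =i pred0 -> exists psi : K -> C, nontrivial_char psi.
Proof.
move=> charC; have [p p_pr pK] := finPcharP K.
have p_gt1 := prime_gt1 p_pr; have p_gt0 := ltnW p_gt1.
have [w prim_w] : exists w : C, p.-primitive_root w.
  have /closed_rootP[w] : size (\poly_(i < p) (1 : C)) != 1%N.
    by rewrite size_poly_eq ?oner_eq0 // gtn_eqF.
  rewrite rootE horner_poly => /eqP w0.
  have wp : w ^+ p = 1.
    apply/eqP; rewrite -subr_eq0 subrX1 -[X in _ * X](eq_bigr _ (fun i _ => mul1r _)).
    by rewrite w0 mulr0.
  have [m prim_w mp] := prim_order_exists p_gt0 wp.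
  case/primeP: (p_pr) => _ /(_ m mp)/pred2P[m1|<-]; last by exists w.
  move: prim_w w0; rewrite m1 => /prim_expr_order; rewrite expr1 => ->.
  under eq_bigr do rewrite expr1n mulr1.
  rewrite sumr_const card_ord => /eqP p0.
  by have := charC p; rewrite inE p_pr p0.
have [v2r lin_v2r bij_v2r] := pprimeChar_vectAxiom pK.
have v2rD (x y : K) : v2r (x + y) = v2r x + v2r y.
  by have := lin_v2r 1 x y; rewrite !scale1r.
have v2r0 : v2r (0 : K) = 0.
  by have := v2rD 0 0; rewrite addr0 => /esym/eqP; rewrite -subr_eq0 addrK => /eqP.
have [i v1i] : exists i, v2r (1 : K) 0 i != 0.
  apply/rV0Pn; apply: contra_neq (oner_neq0 K) => v10.
  exact: (bij_inj bij_v2r (etrans v10 (esym v2r0))).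
pose psi (x : K) : C := w ^+ (v2r x 0 i : 'F_p).
have psiD : {morph psi : x y / x + y >-> x * y}.
  move=> x y; rewrite /psi -exprD.
  by rewrite (v2rD x y) mxE /= [X in (_ %% X)%N]Fp_cast // prim_expr_mod.
exists psi; split=> //.
  by rewrite /psi v2r0 mxE.
exists 1; apply: contra v1i; rewrite /psi -(prim_order_dvd prim_w) => dv.
have lt_p (z : 'F_p) : (z < p)%N by rewrite -[X in (_ < X)%N](Fp_cast p_pr) ltn_ord.
by move: dv; rewrite /dvdn modn_small ?lt_p.
Qed.

Lemma two_neq0_of_odd_card (K : finFieldType) : odd #|K| -> (2 : K) != 0.
Proof.
move=> oddK; apply/negP => /eqP two0.
have two_char : 2%N \in [pchar K] by rewrite inE /= two0.
move: oddK (finNzRing_gt1 K); rewrite (card_pprimeChar two_char).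
by case: (logn _ _) => // n; rewrite expnS oddM.
Qed.

Section GaussSum.
Variables (R : rcfType) (K : finFieldType) (psi : K -> R[i]).
Hypotheses (psiP : nontrivial_char psi) (oddK : odd #|K|).
Let q := #|K|.
Let two0 := two_neq0_of_odd_card oddK.
Let four0 : (4 : K) != 0. Proof. by rewrite (natrM K 2 2) mulf_neq0. Qed.
Let psi0 : psi 0 = 1. Proof. by case: psiP. Qed.
Let psiD x y : psi (x + y) = psi x * psi y. Proof. by case: psiP. Qed.

Definition gauss (s : K) : R[i] := \sum_x psi (s * x ^+ 2).

Lemma gauss_complete_square (s m : K) : s != 0 ->
  \sum_x psi (s * x ^+ 2 + m * x) = gauss s * psi (- (m ^+ 2 / (4 * s))).
Proof.
move=> s0; rewrite (reindex_inj (addIr (- (m / (2 * s))))) /gauss mulr_suml.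
by apply: eq_bigr => x _; rewrite -psiD; congr psi; field; rewrite s0 two0 four0.
Qed.

Lemma normc_gauss (s : K) : s != 0 -> normc (gauss s) ^+ 2 = q%:R.
Proof.
move=> s0; apply: (@complexI R); rewrite sqr_normcC rmorph_nat.
have -> : gauss s * conjc (gauss s) = \sum_y \sum_h psi (s * h ^+ 2) * psi ((2 * s * h) * y).
  rewrite rmorph_sum mulrC mulr_suml; apply: eq_bigr => y _.
  rewrite /= conjc_char // {1}/gauss mulr_sumr (reindex_inj (addIr y)).
  by apply: eq_bigr => h _; rewrite -!psiD; congr psi; ring.
rewrite exchange_big /= (bigD1 0) //= [X in _ + X]big1 ?addr0 => [|h h0].
  by rewrite -mulr_sumr sum_char_mul // expr0n !mulr0 psi0 mul1r eqxx.
by rewrite -mulr_sumr sum_char_mul // !mulf_eq0 (negPf two0) (negPf s0) (negPf h0) mulr0.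
Qed.

Lemma card_sqrt_le2 (y : K) : (#|[set x : K | x ^+ 2 == y]| <= 2)%N.
Proof.
case: (set_0Vmem [set x : K | x ^+ 2 == y]) => [->|[z]]; first by rewrite cards0.
rewrite inE => /eqP <-; apply: (@leq_trans #|[set z; - z]|).
  apply: subset_leq_card; apply/subsetP => x; rewrite !inE -subr_eq0 subr_sqr mulf_eq0.
  by rewrite subr_eq0 addr_eq0.
by rewrite cards2; case: (_ != _).
Qed.

(* For a nonsquare [s], the values [x ^+ 2] and [s * x ^+ 2] cover [K] exactly twice. *)
Lemma gauss_sign (s : K) : s != 0 -> gauss s = gauss 1 \/ gauss s = - gauss 1.
Proof.
move=> s0; case: (boolP [exists z, z ^+ 2 == s]) => [/existsP[z /eqP zs]|/existsPn ns].
  left; rewrite /gauss; have z0 : z != 0 by apply: contraNneq s0 => z0; rewrite -zs z0 expr0n.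
  rewrite [RHS](reindex_inj (mulfI z0)); apply: eq_bigr => x _.
  by rewrite mul1r exprMn zs.
right; pose n1 y := #|[set x : K | x ^+ 2 == y]|.
pose n2 y := #|[set x : K | s * x ^+ 2 == y]|.
have gE (c : K) : gauss c = \sum_y #|[set x : K | c * x ^+ 2 == y]|%:R * psi y.
  rewrite /gauss (partition_big (fun x => c * x ^+ 2) xpredT) //=; apply: eq_bigr => y _.
  rewrite (eq_bigr (fun=> psi y)) => [|x /eqP-> //].
  by rewrite sumr_const mulr_natl cardsE; congr (_ *+ _); apply: eq_card => x; rewrite -!topredE.
have n2E y : n2 y = n1 (y / s).
  rewrite /n2 /n1; congr #|pred_of_set _|; apply/setP => x; rewrite !inE.
  by rewrite -[in RHS](inj_eq (mulfI s0)) [s * (y / s)]mulrC divfK.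
have n10 : n1 0 = 1%N.
  rewrite -(cards1 (0 : K)); congr #|pred_of_set _|; apply/setP => x.
  by rewrite !inE sqrf_eq0.
have le2 y : (n1 y + n2 y <= 2)%N.
  have [->|y0] := eqVneq y 0; first by rewrite n2E mul0r n10.
  case: (set_0Vmem [set x : K | x ^+ 2 == y]) => [E|[z]].
    by rewrite n2E /n1 E cards0 add0n card_sqrt_le2.
  rewrite inE => /eqP zy.
  case: (set_0Vmem [set x : K | s * x ^+ 2 == y]) => [E|[x]].
    by rewrite /n2 E cards0 addn0 card_sqrt_le2.
  rewrite inE => /eqP xy; have x0 : x != 0.
    by apply: contraNneq y0 => x0; rewrite -xy x0 expr0n mulr0.
  by have := ns (z / x); rewrite expr_div_n zy -xy mulfK ?eqxx // expf_neq0.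
have card_fibers (h : K -> K) : (\sum_y #|[set x | h x == y]| = q)%N.
  rewrite -[RHS]sum1_card [RHS](partition_big h xpredT) //=; apply: eq_bigr => y _.
  by rewrite -sum1dep_card.
have eq2 y : (n1 y + n2 y = 2)%N.
  have : (\sum_y (2 - (n1 y + n2 y)) == 0)%N.
    rewrite -(eqn_add2r (\sum_y (n1 y + n2 y))%N) -big_split /=.
    under eq_bigr => z _ do rewrite subnK ?le2 //.
    by rewrite big_split /= !card_fibers sum_nat_const muln2 addnn.
  rewrite sum_nat_eq0 => /forallP/(_ y); rewrite subn_eq0 => le2'.
  by apply/eqP; rewrite eqn_leq le2.
apply/eqP; rewrite -addr_eq0 !gE -big_split /=.
rewrite (eq_bigr (fun y => 2 * psi (1 * y))) => [|y _].
  by rewrite -mulr_sumr sum_char_mul // oner_eq0 mulr0.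
have -> : [set x : K | 1 * x ^+ 2 == y] = [set x | x ^+ 2 == y].
  by apply/setP => x; rewrite !inE mul1r.
by rewrite -mulrDl -natrD mul1r addnC eq2.
Qed.

(** Even powers of Gauss sums do not see the quadratic character; this is why even dimensions lead
    to plain Kloosterman sums, without a quadratic twist. *)
Lemma gauss_sqr (s : K) : s != 0 -> gauss s ^+ 2 = gauss 1 ^+ 2.
Proof. by case/gauss_sign => ->; rewrite ?sqrrN. Qed.

End GaussSum.

(** Stated for an arbitrary orthogonal kernel, since it is applied to vectors, to scalars, and to
    scalars reindexed by an involution. *)
Lemma parseval (R : rcfType) (A B : finType) (e : A -> B -> R[i]) (N : nat) :
    (forall b b', \sum_a e a b * conjc (e a b') = if b == b' then N%:R else 0) ->
  forall w : B -> R[i],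
  \sum_a normc (\sum_b w b * e a b) ^+ 2 = N%:R * \sum_b normc (w b) ^+ 2.
Proof.
move=> orth w; apply: (@complexI R); rewrite rmorphM rmorph_nat !rmorph_sum /=.
transitivity (\sum_a \sum_b \sum_b' w b * conjc (w b') * (e a b * conjc (e a b'))).
  apply: eq_bigr => a _; rewrite sqr_normcC rmorph_sum mulr_suml; apply: eq_bigr => b _.
  rewrite mulr_sumr; apply: eq_bigr => b' _ /=.
  by rewrite rmorphM /= mulrACA.
rewrite exchange_big mulr_sumr; apply: eq_bigr => b _; rewrite exchange_big (bigD1 b) //=.
rewrite -mulr_sumr orth eqxx big1 ?addr0 => [|b' bb']; first by rewrite sqr_normcC mulrC.
by rewrite -mulr_sumr orth eq_sym (negPf bb') mulr0.
Qed.

(** Lagrange's identity: twice the defect is a double sum of squares. *)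
Lemma cauchy_schwarz_sum (R : realFieldType) (I : finType) (P : pred I) (x y : I -> R) :
  (\sum_(i | P i) x i * y i) ^+ 2 <= (\sum_(i | P i) x i ^+ 2) * \sum_(i | P i) y i ^+ 2.
Proof.
rewrite -subr_ge0 -(pmulr_rge0 _ (ltr0Sn R 1)).
suff -> : 2 * ((\sum_(i | P i) x i ^+ 2) * (\sum_(i | P i) y i ^+ 2)
      - (\sum_(i | P i) x i * y i) ^+ 2)
    = \sum_(i | P i) \sum_(j | P j) (x i * y j - x j * y i) ^+ 2.
  by apply: sumr_ge0 => i _; apply: sumr_ge0 => j _; apply: sqr_ge0.
rewrite mulrBr mulr2n mulrDl mul1r.
have E1 : (\sum_(i | P i) x i ^+ 2) * (\sum_(i | P i) y i ^+ 2)
    = \sum_(i | P i) \sum_(j | P j) x i ^+ 2 * y j ^+ 2.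
  by rewrite mulr_suml; apply: eq_bigr => i _; rewrite mulr_sumr.
have E2 : (\sum_(i | P i) x i ^+ 2) * (\sum_(i | P i) y i ^+ 2)
    = \sum_(i | P i) \sum_(j | P j) x j ^+ 2 * y i ^+ 2.
  by rewrite E1 exchange_big.
rewrite {1}E1 E2 expr2 mulr_suml mulr_sumr -big_split -sumrB /=; apply: eq_bigr => i _.
rewrite -big_split /= !mulr_sumr -sumrB; apply: eq_bigr => j _; ring.
Qed.

Section VectorFourier.
Variables (R : rcfType) (K : finFieldType) (psi : K -> R[i]).
Hypotheses (psiP : nontrivial_char psi) (oddK : odd #|K|).
Let q := #|K|.
Let psi0 : psi 0 = 1. Proof. by case: psiP. Qed.
Let psiD x y : psi (x + y) = psi x * psi y. Proof. by case: psiP. Qed.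

Definition dotv d (x y : 'rV[K]_d) : K := \sum_i x 0 i * y 0 i.

Lemma dotvDr d (m x y : 'rV[K]_d) : dotv m (x + y) = dotv m x + dotv m y.
Proof. by rewrite /dotv -big_split; apply: eq_bigr => i _; rewrite mxE mulrDr. Qed.

Lemma dotvDl d (m x y : 'rV[K]_d) : dotv (x + y) m = dotv x m + dotv y m.
Proof. by rewrite /dotv -big_split; apply: eq_bigr => i _; rewrite mxE mulrDl. Qed.

Lemma dotvNr d (m x : 'rV[K]_d) : dotv m (- x) = - dotv m x.
Proof. by rewrite /dotv -sumrN; apply: eq_bigr => i _; rewrite mxE mulrN. Qed.

Lemma dotvC d (x y : 'rV[K]_d) : dotv x y = dotv y x.
Proof. by apply: eq_bigr => i _; rewrite mulrC. Qed.

Lemma sum_rV_prod (C : comNzRingType) d (F : 'I_d -> K -> C) :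
  \sum_(m : 'rV[K]_d) \prod_i F i (m 0 i) = \prod_i \sum_x F i x.
Proof.
rewrite bigA_distr_bigA /= (reindex (fun f : {ffun 'I_d -> K} => \row_i f i)) /=.
  by apply: eq_bigr => f _; apply: eq_bigr => i _; rewrite mxE.
exists (fun m : 'rV_d => [ffun i => m 0 i]) => [f _|m _].
  by apply/ffunP => i; rewrite ffunE mxE.
by apply/rowP => i; rewrite mxE ffunE.
Qed.

Lemma sum_char_dotv d (z : 'rV[K]_d) :
  \sum_m psi (dotv m z) = if z == 0 then (q ^ d)%:R else 0.
Proof.
under eq_bigr => m _ do rewrite /dotv (big_morph psi psiD psi0).
rewrite (sum_rV_prod (fun i x => psi (x * z 0 i))).
have E i : \sum_x psi (x * z 0 i) = if z 0 i == 0 then q%:R else 0.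
  by rewrite -(sum_char_mul _ psiP); apply: eq_bigr => x _; rewrite mulrC.
under eq_bigr => i _ do rewrite E.
case: eqP => [->|/eqP/rV0Pn[i zi]].
  under eq_bigr => i _ do rewrite mxE eqxx.
  by rewrite prodr_const card_ord natrX.
by rewrite (bigD1 i) //= (negPf zi) mul0r.
Qed.

Lemma sum_char_sqnorm d (u : K) (z : 'rV[K]_d) : u != 0 ->
  \sum_m psi (u * sqnorm m + dotv m z) = gauss psi u ^+ d * psi (- (sqnorm z / (4 * u))).
Proof.
move=> u0; have E m : u * sqnorm m + dotv m z = \sum_i (u * m 0 i ^+ 2 + z 0 i * m 0 i).
  by rewrite mulr_sumr -big_split; apply: eq_bigr => i _; rewrite [z 0 i * _]mulrC.
under eq_bigr => m _ do rewrite E (big_morph psi psiD psi0).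
rewrite (sum_rV_prod (fun i x => psi (u * x ^+ 2 + z 0 i * x))).
under eq_bigr => i _ do rewrite gauss_complete_square //.
rewrite big_split /= prodr_const card_ord; congr (_ * _).
by rewrite -(big_morph psi psiD psi0) sumrN mulr_suml.
Qed.

Lemma orth_dotv d (x y : 'rV[K]_d) :
  \sum_m psi (dotv m x) * conjc (psi (dotv m y)) = if x == y then (q ^ d)%:R else 0.
Proof.
rewrite -subr_eq0 -sum_char_dotv; apply: eq_bigr => m _.
by rewrite conjc_char // -psiD dotvDr dotvNr.
Qed.

Lemma orth_mul (x y : K) :
  \sum_m psi (m * x) * conjc (psi (m * y)) = if x == y then q%:R else 0.
Proof.
rewrite -subr_eq0 -(sum_char_mul _ psiP); apply: eq_bigr => m _.
by rewrite conjc_char // -psiD -mulrN -mulrDr mulrC.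
Qed.

End VectorFourier.

(** * Second moment of the distance counts *)

Section DistanceCount.
Variables (R : rcfType) (K : finFieldType) (psi : K -> R[i]).
Hypotheses (psiP : nontrivial_char psi) (oddK : odd #|K|).
Variable d : nat.
Implicit Types (E G : {set 'rV[K]_d}) (m x y z : 'rV[K]_d) (r s t u : K).
Let q : R := #|K|%:R.
Let psi0 : psi 0 = 1. Proof. by case: psiP. Qed.
Let psiD (x y : K) : psi (x + y) = psi x * psi y. Proof. by case: psiP. Qed.
Let two0 := two_neq0_of_odd_card oddK.
Let four0 : (4 : K) != 0. Proof. by rewrite (natrM K 2 2) mulf_neq0. Qed.
Let q_gt0 : 0 < q. Proof. by rewrite ltr0n (ltnW (finNzRing_gt1 K)). Qed.
Let qd_gt0 : 0 < q ^+ d. Proof. exact: exprn_gt0. Qed.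

Definition ft E m : R[i] := \sum_(x in E) psi (dotv m x).

Definition sphere_mass E r : R := \sum_(m | sqnorm m == r) normc (ft E m) ^+ 2.

Lemma sphere_mass_ge0 E r : 0 <= sphere_mass E r.
Proof. by apply: sumr_ge0 => m _; apply: sqr_ge0. Qed.

Lemma ft_parseval E : \sum_m normc (ft E m) ^+ 2 = q ^+ d * #|E|%:R.
Proof.
have := parseval (orth_dotv psiP (d := d)) (fun x => (x \in E)%:R).
rewrite natrX => P; transitivity
    (\sum_m normc (\sum_x (x \in E)%:R * psi (dotv m x)) ^+ 2).
  apply: eq_bigr => m _; congr (normc _ ^+ 2); rewrite /ft big_mkcond.
  by apply: eq_bigr => x _; case: (x \in E); rewrite ?mul1r ?mul0r.
rewrite P; congr (_ * _).
rewrite -sum1_card natr_sum [RHS]big_mkcond; apply: eq_bigr => x _.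
by rewrite normc_nat; case: (x \in E); rewrite ?expr1n ?expr0n.
Qed.

Lemma sum_sphere_mass E : \sum_r sphere_mass E r = q ^+ d * #|E|%:R.
Proof. by rewrite -ft_parseval [RHS](partition_big (@sqnorm K d) xpredT). Qed.

Variables E G : {set 'rV[K]_d}.
Let e : R := #|E|%:R.
Let f : R := #|G|%:R.
Let e_ge0 : 0 <= e. Proof. exact: ler0n. Qed.
Let f_ge0 : 0 <= f. Proof. exact: ler0n. Qed.

Definition dist_count t : nat :=
  #|[set p : 'rV[K]_d * 'rV[K]_d | [&& p.1 \in E, p.2 \in G & sqnorm (p.1 - p.2) == t]]|.
Definition dist_sum s : R[i] := \sum_(x in E) \sum_(y in G) psi (s * sqnorm (x - y)).
Definition sphere_corr r : R[i] := \sum_(m | sqnorm m == r) ft E m * conjc (ft G m).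

Local Notation nu := dist_count.
Local Notation A := dist_sum.
Local Notation H := sphere_corr.

Lemma dist_sumE s : A s = \sum_t (nu t)%:R * psi (s * t).
Proof.
rewrite /A pair_big /= (partition_big (fun p => sqnorm (p.1 - p.2)) xpredT) //=.
apply: eq_bigr => t _; rewrite (eq_bigr (fun=> psi (s * t))) => [|p /andP[_ /eqP->] //].
rewrite sumr_const mulr_natl /nu cardsE; congr (_ *+ _); apply: eq_card => p.
by rewrite -!topredE /= andbA.
Qed.

Lemma sum_dist_count : (\sum_t nu t = #|E| * #|G|)%N.
Proof.
rewrite -cardsX -sum1_card (partition_big (fun p => sqnorm (p.1 - p.2)) xpredT) //=.
apply: eq_bigr => t _; rewrite /nu -sum1dep_card; apply: eq_bigl => p.
by rewrite inE andbA.
Qed.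

Lemma dist_sum0 : A 0 = (#|E| * #|G|)%:R.
Proof.
rewrite dist_sumE -sum_dist_count natr_sum; apply: eq_bigr => t _.
by rewrite mul0r psi0 mulr1.
Qed.

Lemma sum_normc_dist_sum : \sum_s normc (A s) ^+ 2 = q * \sum_t (nu t)%:R ^+ 2.
Proof.
have := parseval (orth_mul psiP) (fun t => (nu t)%:R).
under eq_bigr do rewrite -dist_sumE.
by under [in X in _ = X -> _]eq_bigr do rewrite normc_nat.
Qed.

Lemma ft_corrE m : ft E m * conjc (ft G m) = \sum_(x in E) \sum_(y in G) psi (dotv m (x - y)).
Proof.
rewrite /ft mulr_suml; apply: eq_bigr => x _; rewrite rmorph_sum mulr_sumr.
by apply: eq_bigr => y _; rewrite /= conjc_char // -psiD dotvDr dotvNr.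
Qed.

Lemma sum_corr_char u :
  \sum_m psi (u * sqnorm m) * (ft E m * conjc (ft G m)) = \sum_r H r * psi (u * r).
Proof.
rewrite (partition_big (@sqnorm K d) xpredT) //=; apply: eq_bigr => r _.
by rewrite /H mulr_suml; apply: eq_bigr => m /eqP->; rewrite mulrC.
Qed.

(** Expanding the right side over [E] and [G] leaves, for each pair, the sum over [m] of
    [psi (u * sqnorm m + dotv m (x - y))], which [sum_char_sqnorm] evaluates by completing
    squares. *)
Lemma dist_sum_dual u : u != 0 ->
  gauss psi u ^+ d * A (- (4 * u)^-1) = \sum_r H r * psi (u * r).
Proof.
move=> u0; rewrite -sum_corr_char.
under [RHS]eq_bigr => m _ do rewrite ft_corrE mulr_sumr.
rewrite [RHS]exchange_big mulr_sumr; apply: eq_bigr => x _ /=.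
under [RHS]eq_bigr => m _ do rewrite mulr_sumr.
rewrite [RHS]exchange_big mulr_sumr; apply: eq_bigr => y _ /=.
under [RHS]eq_bigr => m _ do rewrite -psiD.
by rewrite sum_char_sqnorm //; congr (_ * psi _); rewrite mulNr mulrC.
Qed.

Lemma normc_sphere_corr r : normc (H r) ^+ 2 <= sphere_mass E r * sphere_mass G r.
Proof.
apply: le_trans (cauchy_schwarz_sum _ _ _).
rewrite lerXn2r ?nnegrE ?normc_ge0 ?sumr_ge0 // => [m _|].
  by rewrite mulr_ge0 ?normc_ge0.
apply: le_trans (le_normc_sum _ _ _) _; apply: ler_sum => m _.
by rewrite normcM normc_conj.
Qed.

Lemma normc_gauss_exp u : u != 0 -> normc (gauss psi u ^+ d) ^+ 2 = q ^+ d.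
Proof. by move=> u0; rewrite normcX exprAC normc_gauss. Qed.

Lemma sum_normc_corr_le : \sum_m normc (ft E m) * normc (ft G m) <= q ^+ d * Num.sqrt (e * f).
Proof.
rewrite -[leLHS]ger0_norm; last by apply: sumr_ge0 => m _; rewrite mulr_ge0 ?normc_ge0.
rewrite -sqrtr_sqr -[q ^+ d]ger0_norm ?(ltW qd_gt0) // -sqrtr_sqr -sqrtrM ?sqr_ge0 //.
apply: ler_wsqrtr; apply: le_trans (cauchy_schwarz_sum _ _ _) _.
by rewrite !ft_parseval le_eqVlt; apply/orP; left; apply/eqP; rewrite -/e -/f; ring.
Qed.

(** Duality, then the triangle inequality over all frequencies, Cauchy-Schwarz and Parseval; no
    information on spheres is used. *)
Lemma normc_dist_sum_le s : s != 0 -> normc (A s) ^+ 2 <= q ^+ d * e * f.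
Proof.
move=> s0; pose u := - (4 * s)^-1.
have u0 : u != 0 by rewrite oppr_eq0 invr_eq0 mulf_neq0.
have su : - (4 * u)^-1 = s by rewrite /u mulrN invrN opprK invfM invrK mulrA mulVf ?mul1r.
have := dist_sum_dual u0; rewrite su -sum_corr_char => /(congr1 (fun z : R[i] => normc z ^+ 2)).
rewrite normcM exprMn normc_gauss_exp // => AE.
rewrite -(ler_pM2l qd_gt0) AE.
have -> : q ^+ d * (q ^+ d * e * f) = (q ^+ d * Num.sqrt (e * f)) ^+ 2.
  by rewrite exprMn sqr_sqrtr ?mulr_ge0 //; ring.
rewrite lerXn2r ?nnegrE ?normc_ge0 ?mulr_ge0 ?sqrtr_ge0 ?(ltW qd_gt0) //.
apply: le_trans sum_normc_corr_le; apply: le_trans (le_normc_sum _ _ _) _.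
by apply: ler_sum => m _; rewrite !normcM normc_conj normc_char // mul1r.
Qed.

(** The change of variable in [dist_sum_dual]. With [0^-1 = 0] it is an involution of all of [K]
    fixing [0], so whole sums can be reindexed. *)
Let inv4 u := - (4 * u)^-1.

Let inv4K : involutive inv4.
Proof.
move=> u; rewrite /inv4 mulrN invrN opprK invfM invrK mulrA mulVf ?mul1r //.
Qed.

Let inv4_eq0 u : (inv4 u == 0) = (u == 0).
Proof. by rewrite oppr_eq0 invr_eq0 mulf_eq0 (negPf four0). Qed.

Let normc_A0 : normc (A 0) = e * f.
Proof. by rewrite dist_sum0 normc_nat natrM. Qed.

Lemma dist_count_out t : t \notin dist_set E G -> nu t = 0%N.
Proof.
move=> tD; apply/eqP; rewrite cards_eq0; apply/eqP/setP => p; rewrite !inE.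
apply: contraNF tD => /and3P[p1 p2 /eqP <-]; exact: imset2_f.
Qed.

Lemma dist_set_lower_bound (P : pred K) :
  (\sum_(t | P t) (nu t)%:R) ^+ 2 <= #|dist_set E G|%:R * \sum_(t | P t) (nu t)%:R ^+ 2 :> R.
Proof.
have -> : \sum_(t | P t) (nu t)%:R = \sum_(t | P t) (t \in dist_set E G)%:R * (nu t)%:R :> R.
  apply: eq_bigr => t _; case: (boolP (t \in _)) => [|/dist_count_out->]; first by rewrite mul1r.
  by rewrite mul0r.
apply: le_trans (cauchy_schwarz_sum _ _ _) _; apply: ler_wpM2r.
  by apply: sumr_ge0 => t _; apply: sqr_ge0.
rewrite -sum1_card natr_sum big_mkcond [leRHS]big_mkcond /=; apply: ler_sum => t _.
by case: (P t); case: (t \in _); rewrite ?expr1n ?expr0n.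
Qed.

Lemma sum_dist_count_sqr_le :
  \sum_t (nu t)%:R ^+ 2 <= (e * f) ^+ 2 / q + q ^+ d * (e * f).
Proof.
rewrite -(ler_pM2l q_gt0) -sum_normc_dist_sum (bigD1 0) //= normc_A0 mulrDr.
rewrite [q * (_ / q)]mulrC divfK ?gt_eqF // lerD2l.
apply: (@le_trans _ _ (\sum_(s | s != 0) q ^+ d * (e * f))).
  by apply: ler_sum => s s0; rewrite mulrA normc_dist_sum_le.
rewrite sumr_const -mulr_natl; apply: ler_wpM2r.
  by rewrite !mulr_ge0 ?(ltW qd_gt0).
by rewrite ler_nat; apply: max_card.
Qed.

Lemma sum_normc_corr_char (w : K -> R[i]) :
  \sum_u normc (\sum_r w r * psi (u * r)) ^+ 2 = q * \sum_r normc (w r) ^+ 2.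
Proof. exact: parseval (orth_mul psiP) w. Qed.

(** The frequency [s = 0] gives the main term; the others are carried by duality to the transform of
    [H], and Parseval applies once the nonnegative term at [u = 0] is added. *)
Lemma sum_dist_count_sqr_corr :
  \sum_t (nu t)%:R ^+ 2 <= (e * f) ^+ 2 / q + (\sum_r normc (H r) ^+ 2) / q ^+ d.
Proof.
rewrite -(ler_pM2l q_gt0) -sum_normc_dist_sum (bigD1 0) //= normc_A0 mulrDr.
rewrite [q * (_ / q)]mulrC divfK ?gt_eqF // lerD2l mulrA -sum_normc_corr_char.
rewrite ler_pdivlMr // (reindex_inj (inv_inj inv4K)) /= mulr_suml.
rewrite [leLHS](eq_bigl (fun u => u != 0)) => [|u]; last by rewrite inv4_eq0.
rewrite [leRHS](bigID (fun u => u != 0)) /= -[leLHS]addr0; apply: lerD; last first.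
  by apply: sumr_ge0 => u _; apply: sqr_ge0.
apply: ler_sum => u u0; rewrite -dist_sum_dual // normcM exprMn normc_gauss_exp //.
by rewrite mulrC.
Qed.

Lemma sum_corr_nonzero_le (M : R) : (forall r, r != 0 -> sphere_mass E r <= M) ->
  \sum_(r | r != 0) normc (H r) ^+ 2 <= M * (q ^+ d * f).
Proof.
move=> leM; have M0 : 0 <= M by apply: le_trans (sphere_mass_ge0 E 1) (leM 1 (oner_neq0 K)).
rewrite -sum_sphere_mass mulr_sumr [leRHS](bigID (fun u => u != 0)) /= -[leLHS]addr0.
apply: lerD; last by apply: sumr_ge0 => r _; rewrite mulr_ge0 ?sphere_mass_ge0.
apply: ler_sum => r r0; apply: le_trans (normc_sphere_corr r) _.
by apply: ler_wpM2r; rewrite ?sphere_mass_ge0 ?leM.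
Qed.

Lemma dist_count_inversion t : (#|K|)%:R * (nu t)%:R = \sum_s psi (- (s * t)) * A s.
Proof.
under eq_bigr => s _ do rewrite dist_sumE mulr_sumr.
rewrite exchange_big (bigD1 t) //= [X in _ = _ + X]big1 ?addr0 => [|t' tt'].
  under eq_bigr => s _ do rewrite mulrCA -psiD addNr psi0 mulr1.
  by rewrite sumr_const mulr_natl.
under eq_bigr => s _.
  rewrite mulrCA -psiD -mulrN -mulrDr [s * _]mulrC.
  over.
by rewrite -mulr_sumr sum_char_mul // addrC subr_eq0 (negPf tt') mulr0.
Qed.

Lemma dist_count0_le : q * (nu 0)%:R <= e * f + (q - 1) * Num.sqrt (q ^+ d * e * f).
Proof.
have := congr1 (@normc R) (dist_count_inversion 0).
rewrite normcM !normc_nat -/q => ->; apply: le_trans (le_normc_sum _ _ _) _.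
rewrite (bigD1 0) //= normcM normc_char // mul1r normc_A0 lerD2l.
apply: (@le_trans _ _ (\sum_(s : K | s != 0) Num.sqrt (q ^+ d * e * f))).
  apply: ler_sum => s s0; rewrite normcM normc_char // mul1r.
  rewrite -[normc _]ger0_norm ?normc_ge0 // -sqrtr_sqr.
  by apply: ler_wsqrtr; apply: normc_dist_sum_le.
rewrite sumr_const -mulr_natl; apply: ler_wpM2r; first exact: sqrtr_ge0.
have -> : #|(fun i : K => i != 0)| = #|K|.-1 by rewrite -(cardC1 (0 : K)); apply: eq_card.
by rewrite lerBrDr natr1 prednK // (ltnW (finNzRing_gt1 K)).
Qed.

(** Each sphere is bounded by the whole of Parseval. It serves for zero radius, where no better mass
    bound is at hand. *)
Lemma normc_sphere_corr_le r : normc (H r) ^+ 2 <= (q ^+ d) ^+ 2 * (e * f).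
Proof.
apply: le_trans (normc_sphere_corr r) _.
have mass_le (F : {set 'rV[K]_d}) : sphere_mass F r <= q ^+ d * #|F|%:R.
  rewrite -sum_sphere_mass (bigD1 r) //= lerDl.
  by apply: sumr_ge0 => r' _; apply: sphere_mass_ge0.
have -> : (q ^+ d) ^+ 2 * (e * f) = (q ^+ d * e) * (q ^+ d * f) by ring.
by apply: ler_pM; rewrite ?sphere_mass_ge0 ?mass_le.
Qed.

Lemma gauss_exp_even u : ~~ odd d -> u != 0 -> gauss psi u ^+ d = gauss psi 1 ^+ d.
Proof.
by move=> d2 u0; rewrite -[d]even_halfK // -mul2n !exprM gauss_sqr.
Qed.

(* For [t != 0] the zero-radius term [H 0], the only one without decay in even
   dimension, enters with the harmless weight [-1]. *)
Lemma dist_count_nonzero t : ~~ odd d -> t != 0 ->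
  (#|K|)%:R * (nu t)%:R = A 0 - (gauss psi 1 ^+ d)^-1 * H 0
   + (gauss psi 1 ^+ d)^-1 * \sum_u (if u == 0 then 0 else
       \sum_r (if r == 0 then 0 else H r) * psi (u * r)) * psi (t * - inv4 u).
Proof.
move=> d2 t0; set g := _ ^+ d.
have g0 : g != 0.
  have := normc_gauss_exp (oner_neq0 K); rewrite -/g => gE.
  apply: contraTneq qd_gt0 => g0; rewrite -gE g0 normc0 expr0n ltxx //.
rewrite dist_count_inversion (bigD1 0) //= mul0r oppr0 psi0 mul1r -addrA.
congr (_ + _); rewrite (reindex_inj (inv_inj inv4K)) /=.
rewrite (eq_bigl (fun u => u != 0)) => [|u]; last by rewrite inv4_eq0.
have AE u : u != 0 -> A (inv4 u) = g^-1 * (H 0 + \sum_r (if r == 0 then 0 else H r) * psi (u * r)).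
  move=> u0; apply: (mulfI g0); rewrite mulVKf // -[g](gauss_exp_even d2 u0).
  rewrite dist_sum_dual // (bigD1 0) //= mulr0 psi0 mulr1; congr (_ + _).
  rewrite [RHS](bigD1 0) //= eqxx mul0r add0r; apply: eq_bigr => r /negPf r0.
  by rewrite r0.
have sum_psi : \sum_(u | u != 0) psi (t * - inv4 u) = -1.
  have : \sum_s psi (t * s) = 0 by rewrite sum_char_mul // (negPf t0).
  rewrite (bigD1 0) //= mulr0 psi0 => /eqP; rewrite addrC addr_eq0 => /eqP <-.
  have inj_h : injective (fun u => - inv4 u) by move=> u v /oppr_inj/(inv_inj inv4K).
  rewrite [RHS](reindex_inj inj_h) /=.
  by apply: eq_bigl => u; rewrite oppr_eq0 inv4_eq0.
transitivity (\sum_(u | u != 0) (g^-1 * H 0 * psi (t * - inv4 u) +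
    g^-1 * ((\sum_r (if r == 0 then 0 else H r) * psi (u * r)) * psi (t * - inv4 u)))).
  apply: eq_bigr => u u0; rewrite AE // mulrN [t * _]mulrC; ring.
rewrite big_split -!mulr_sumr sum_psi mulrN1; congr (_ + _ * _).
rewrite [RHS](bigD1 0) //= eqxx mul0r add0r; apply: eq_bigr => u /negPf u0.
by rewrite u0.
Qed.

(** The three terms of [dist_count_nonzero] are squared with a loss of 3. The zero radius enters as
    a constant in [t], not through Parseval, which gains a factor [q]: [q ^+ d / q] instead of
    [q ^+ d]. The last term is handled by Parseval twice. *)
Lemma sum_dist_count_nonzero_le (M : R) : ~~ odd d ->
    (forall r, r != 0 -> sphere_mass E r <= M) ->
  \sum_(t | t != 0) (nu t)%:R ^+ 2 <=
    3 * ((e * f) ^+ 2 / q + q ^+ d / q * (e * f) + M * f).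
Proof.
move=> d2 leM; set g := gauss psi 1 ^+ d.
pose w u : R[i] := if u == 0 then 0 else \sum_r (if r == 0 then 0 else H r) * psi (u * r).
pose rho t := \sum_u w u * psi (t * - inv4 u).
have nE : normc g^-1 ^+ 2 = (q ^+ d)^-1.
  by rewrite normcV exprVn normc_gauss_exp // oner_neq0.
have sum_rho : \sum_t normc (rho t) ^+ 2 = q * \sum_u normc (w u) ^+ 2.
  apply: parseval => u v; rewrite orth_mul //.
  by rewrite eqr_opp (inj_eq (inv_inj inv4K)).
have sum_w : \sum_u normc (w u) ^+ 2 <= q * (M * (q ^+ d * f)).
  apply: (@le_trans _ _ (q * \sum_r normc (if r == 0 then 0 else H r) ^+ 2)).
    rewrite -sum_normc_corr_char; apply: ler_sum => u _; rewrite /w.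
    by case: eqP => // _; rewrite normc0 expr0n sqr_ge0.
  rewrite ler_pM2l //; apply: le_trans (sum_corr_nonzero_le leM).
  rewrite (bigD1 0) //= eqxx normc0 expr0n add0r.
  by apply: ler_sum => r /negPf->.
have pointwise t : t != 0 -> (q * (nu t)%:R) ^+ 2 <=
    3 * ((e * f) ^+ 2 + (q ^+ d)^-1 * normc (H 0) ^+ 2 + (q ^+ d)^-1 * normc (rho t) ^+ 2).
  move=> t0; have := congr1 (@normc R) (dist_count_nonzero d2 t0).
  rewrite -/g -/(rho t) normcM !normc_nat -/q => ->.
  apply: (@le_trans _ _ ((e * f + normc g^-1 * normc (H 0) + normc g^-1 * normc (rho t)) ^+ 2)).
    rewrite lerXn2r ?nnegrE ?normc_ge0 ?addr_ge0 ?mulr_ge0 ?normc_ge0 //.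
    apply: le_trans (le_normcD _ _) _; rewrite normcM lerD2r.
    by apply: le_trans (le_normcD _ _) _; rewrite (normcN _) normcM normc_A0.
  rewrite -nE -!exprMn; move: (e * f) (_ * normc (H 0)) (_ * normc (rho t)) => x y z.
  have := sqr_ge0 (x - y); have := sqr_ge0 (y - z); have := sqr_ge0 (x - z); nra.
rewrite -(ler_pM2l (exprn_gt0 2 q_gt0)) mulr_sumr.
under eq_bigr do rewrite -exprMn.
have Z_gt0 : 0 < q ^+ d := qd_gt0.
set Z := q ^+ d in nE Z_gt0 pointwise sum_w *.
have cH : Z^-1 * normc (H 0) ^+ 2 <= Z * (e * f).
  by rewrite mulrC ler_pdivrMr // mulrAC -expr2; apply: normc_sphere_corr_le.
have cW : Z^-1 * (q * \sum_u normc (w u) ^+ 2) <= q ^+ 2 * (M * f).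
  rewrite mulrC ler_pdivrMr //.
  have -> : q ^+ 2 * (M * f) * Z = q * (q * (M * (Z * f))) by ring.
  by rewrite ler_pM2l.
pose F t := 3 * ((e * f) ^+ 2 + Z^-1 * normc (H 0) ^+ 2 + Z^-1 * normc (rho t) ^+ 2).
have F_ge0 t : 0 <= F t.
  have Zi : 0 <= Z^-1 by rewrite invr_ge0 ltW.
  by rewrite /F; apply: mulr_ge0 => //; rewrite !addr_ge0 ?sqr_ge0 // mulr_ge0 ?sqr_ge0.
apply: (@le_trans _ _ (\sum_t F t)).
  rewrite [leRHS](bigID (fun t => t != 0)) /= -[leLHS]addr0; apply: lerD.
    exact: ler_sum.
  exact: sumr_ge0.
rewrite -mulr_sumr big_split /= sumr_const -mulr_sumr sum_rho -[_ *+ #|_|]mulr_natl -/q.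
have -> : q ^+ 2 * (3 * ((e * f) ^+ 2 / q + Z / q * (e * f) + M * f)) =
    3 * (q * ((e * f) ^+ 2 + Z * (e * f)) + q ^+ 2 * (M * f)) by field; rewrite gt_eqF.
by rewrite ler_pM2l // lerD // ler_pM2l // lerD2l.
Qed.

End DistanceCount.

(** * Fourier mass on spheres *)

Section SphereMassEven.
Variables (R : rcfType) (K : finFieldType) (psi : K -> R[i]).
Hypotheses (psiP : nontrivial_char psi) (oddK : odd #|K|).
Variable d : nat.
Implicit Types (E : {set 'rV[K]_d}) (z : 'rV[K]_d) (r : K).
Let q : R := #|K|%:R.
Let psi0 : psi 0 = 1. Proof. by case: psiP. Qed.
Let psiD (x y : K) : psi (x + y) = psi x * psi y. Proof. by case: psiP. Qed.
Let q_gt0 : 0 < q. Proof. by rewrite ltr0n (ltnW (finNzRing_gt1 K)). Qed.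

(** The sphere is detected by the sum over [s] of [psi (s * (sqnorm m - r))]. The term [s = 0] sees
    only [z = 0]; the others form a Kloosterman sum with parameters [- r] and [- sqnorm z / 4]. *)
Lemma sphere_ft_le r z : ~~ odd d -> r != 0 ->
  q * normc (\sum_(m | sqnorm m == r) psi (dotv m z)) <=
    (z == 0)%:R * q ^+ d + Num.sqrt (q ^+ d) * (3 * Num.sqrt q).
Proof.
move=> d2 r0.
have qE : q = normc (#|K|%:R : R[i]) by rewrite normc_nat.
rewrite [X in X * _ <= _]qE -normcM.
have -> : #|K|%:R * \sum_(m | sqnorm m == r) psi (dotv m z)
    = \sum_s psi (- (s * r)) * \sum_m psi (s * sqnorm m + dotv m z).
  under [RHS]eq_bigr do rewrite mulr_sumr.
  rewrite exchange_big mulr_sumr big_mkcond; apply: eq_bigr => m _ /=.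
  under [RHS]eq_bigr => s _.
    rewrite psiD mulrA -psiD (_ : - _ + _ = (sqnorm m - r) * s); last by ring.
    over.
  by rewrite -mulr_suml sum_char_mul // subr_eq0; case: eqP; rewrite ?mul0r.
rewrite (bigD1 0) //= mul0r oppr0 psi0 mul1r.
have -> : \sum_m psi (0 * sqnorm m + dotv m z) = ((z == 0)%:R * (#|K| ^ d)%:R : R[i]).
  under eq_bigr do rewrite mul0r add0r.
  by rewrite sum_char_dotv //; case: eqP; rewrite ?mul1r ?mul0r.
have -> : \sum_(s | s != 0) psi (- (s * r)) * \sum_m psi (s * sqnorm m + dotv m z)
    = gauss psi 1 ^+ d * kloosterman psi (- r) (- (sqnorm z / 4)).
  rewrite /kloosterman mulr_sumr; apply: eq_bigr => s s0.
  rewrite sum_char_sqnorm // gauss_exp_even // mulrCA -psiD.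
  by congr (_ * psi _); rewrite mulNr [r * s]mulrC invfM mulNr !mulrA.
apply: le_trans (le_normcD _ _) _; rewrite !normcM; apply: lerD.
  by rewrite !normc_nat natrX.
have -> : normc (gauss psi 1 ^+ d) = Num.sqrt (q ^+ d).
  rewrite -(normc_gauss_exp psiP oddK d (oner_neq0 K)) sqrtr_sqr ger0_norm //.
  exact: normc_ge0.
apply: ler_wpM2l; first exact: sqrtr_ge0.
(* For isotropic [z] the Kloosterman sum degenerates to a complete character sum without its term at
   zero, that is [-1]. *)
have [z0|z0] := eqVneq (sqnorm z) 0; last first.
  apply: kloosterman_bound => //; first by rewrite oppr_eq0.
  rewrite oppr_eq0 mulf_eq0 (negPf z0) invr_eq0 (natrM K 2 2) mulf_eq0.
  by rewrite (negPf (two_neq0_of_odd_card oddK)).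
have -> : kloosterman psi (- r) (- (sqnorm z / 4)) = -1.
  have : \sum_s psi (- r * s) = 0 by rewrite sum_char_mul // oppr_eq0 (negPf r0).
  rewrite (bigD1 0) //= mulr0 psi0 => /eqP; rewrite addrC addr_eq0 => /eqP <-.
  by apply: eq_bigr => s _; rewrite z0 mul0r oppr0 mul0r addr0.
rewrite (normcN _) normc1.
have : 1 <= Num.sqrt q by rewrite -sqrtr1 ler_wsqrtr // ler1n (ltnW (finNzRing_gt1 K)).
by lra.
Qed.

(** Opening the square gives the transform of the sphere at [x - y]: the diagonal contributes the
    first term, and the Kloosterman bound over all pairs the second. *)
Lemma sphere_mass_even E r : ~~ odd d -> (0 < d)%N -> r != 0 ->
  sphere_mass psi E r <=
    q ^+ d / q * #|E|%:R + 3 * Num.sqrt (q ^+ (d - 1)) * #|E|%:R ^+ 2.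
Proof.
move=> d2 d0 r0.
have massE : ((sphere_mass psi E r)%:C)%C =
    \sum_(x in E) \sum_(y in E) \sum_(m | sqnorm m == r) psi (dotv m (x - y)).
  rewrite rmorph_sum /=; under eq_bigr => m _ do rewrite sqr_normcC ft_corrE //.
  by rewrite exchange_big; apply: eq_bigr => x _; rewrite exchange_big.
have := congr1 (@normc R) massE; rewrite normcR ger0_norm ?sphere_mass_ge0 // => ->.
have sqrtE : Num.sqrt (q ^+ d) * Num.sqrt q = q * Num.sqrt (q ^+ (d - 1)).
  rewrite -[X in X * Num.sqrt (q ^+ (d - 1))](ger0_norm (ltW q_gt0)) -sqrtr_sqr.
  rewrite -!sqrtrM ?exprn_ge0 ?sqr_ge0 ?ltW //; congr Num.sqrt.
  by rewrite -exprSr -exprD; congr (_ ^+ _); lia.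
rewrite -(ler_pM2l q_gt0).
apply: (@le_trans _ _ (\sum_(x in E) \sum_(y in E)
   ((x - y == 0)%:R * q ^+ d + Num.sqrt (q ^+ d) * (3 * Num.sqrt q)))).
  apply: (@le_trans _ _ (\sum_(x in E) \sum_(y in E)
     q * normc (\sum_(m | sqnorm m == r) psi (dotv m (x - y))))).
    under [leRHS]eq_bigr do rewrite -mulr_sumr.
    rewrite -[leRHS]mulr_sumr ler_pM2l //; apply: le_trans (le_normc_sum _ _ _) _.
    by apply: ler_sum => x _; apply: le_normc_sum.
  by apply: ler_sum => x _; apply: ler_sum => y _; apply: sphere_ft_le.
have -> : \sum_(x in E) \sum_(y in E)
   ((x - y == 0)%:R * q ^+ d + Num.sqrt (q ^+ d) * (3 * Num.sqrt q))
   = \sum_(x in E) (q ^+ d + (Num.sqrt (q ^+ d) * (3 * Num.sqrt q)) *+ #|E|).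
  apply: eq_bigr => x xE; rewrite big_split /= sumr_const (bigD1 x) //= subrr eqxx mul1r.
  rewrite big1 ?addr0 // => y /andP[_ yx].
  by rewrite subr_eq0 eq_sym (negPf yx) mul0r.
rewrite sumr_const -[_ *+ #|E|]mulr_natr -[_ *+ #|E|]mulr_natr mulrCA sqrtE.
by rewrite le_eqVlt; apply/orP; left; apply/eqP; field; rewrite gt_eqF.
Qed.

End SphereMassEven.

(** * Circles in the plane *)

Section CircleMass.
Variables (R : rcfType) (K : finFieldType) (psi : K -> R[i]).
Hypotheses (psiP : nontrivial_char psi) (oddK : odd #|K|).
Implicit Types (E : {set 'rV[K]_2}) (a k x : 'rV[K]_2) (r : K).
Let q : R := #|K|%:R.
Let psiD (x y : K) : psi (x + y) = psi x * psi y. Proof. by case: psiP. Qed.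
Let two0 := two_neq0_of_odd_card oddK.

Lemma sqnorm2E x : sqnorm x = x 0 0 ^+ 2 + x 0 1 ^+ 2.
Proof.
by rewrite /sqnorm !big_ord_recl big_ord0 addr0; congr (_ + x 0 _ ^+ 2); apply: val_inj.
Qed.

Lemma sqnormN d (x : 'rV[K]_d) : sqnorm (- x) = sqnorm x.
Proof. by apply: eq_bigr => i _; rewrite mxE sqrrN. Qed.

Lemma row2P (x y : 'rV[K]_2) : x 0 0 = y 0 0 -> x 0 1 = y 0 1 -> x = y.
Proof.
move=> e0 e1; apply/rowP => -[[|[|//]] lt_i].
  by rewrite (_ : Ordinal _ = 0) //; apply: val_inj.
by rewrite (_ : Ordinal _ = 1) //; apply: val_inj.
Qed.

(** Subtracting the two equations puts the common points on a line orthogonal to [k]. Along that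
    line, starting from a common point [a0], the circle equation becomes [tau * (tau - t1) = 0]. *)
Lemma card_circle_meet k r : k != 0 -> r != 0 ->
  (#|[set a : 'rV[K]_2 | (sqnorm a == r) && (sqnorm (k - a) == r)]| <= 2)%N.
Proof.
move=> k0 r0; set T := [set a | _].
case: (set_0Vmem T) => [->|[a0 a0T]]; first by rewrite cards0.
have TP a : a \in T -> a 0 0 ^+ 2 + a 0 1 ^+ 2 = r /\
    k 0 0 ^+ 2 + k 0 1 ^+ 2 = 2 * (k 0 0 * a 0 0 + k 0 1 * a 0 1).
  rewrite inE !sqnorm2E !mxE => /andP[/eqP ar /eqP E]; split=> //.
  apply/eqP; rewrite -subr_eq0; apply/eqP; rewrite -(subrr r) -{1}E -ar; ring.
have [na0 ka0] := TP _ a0T; set N := k 0 0 ^+ 2 + k 0 1 ^+ 2 in TP ka0.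
(* An isotropic [k] would be orthogonal to [a0], which in a plane forces [sqnorm a0 = 0] against
   [r != 0], or else [k = 0]. *)
have N0 : N != 0.
  apply: contraNneq r0 => N0; rewrite N0 in ka0.
  have dot0 : k 0 0 * a0 0 0 + k 0 1 * a0 0 1 = 0.
    by apply/eqP; move/esym/eqP: ka0; rewrite mulf_eq0 (negPf two0).
  have k00 : k 0 0 ^+ 2 * r = 0.
    rewrite -na0; transitivity (a0 0 1 ^+ 2 * N +
      (k 0 0 * a0 0 0 + k 0 1 * a0 0 1) * (k 0 0 * a0 0 0 - k 0 1 * a0 0 1)).
      by rewrite /N; ring.
    by rewrite N0 dot0 mulr0 mul0r addr0.
  apply: contraNT k0 => r0; have k0 : k 0 0 = 0.
    by move/eqP: k00; rewrite mulf_eq0 (negPf r0) orbF sqrf_eq0 => /eqP.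
  have k1 : k 0 1 = 0.
    by move/eqP: N0; rewrite /N k0 expr0n add0r sqrf_eq0 => /eqP.
  by apply/eqP/row2P; rewrite !mxE.
pose tau a : K := (k 0 0 * (a 0 1 - a0 0 1) - k 0 1 * (a 0 0 - a0 0 0)) / N.
pose t1 : K := - (2 * (k 0 0 * a0 0 1 - k 0 1 * a0 0 0)) / N.
pose a1 : 'rV[K]_2 := \row_i (if i == 0 then a0 0 0 - t1 * k 0 1 else a0 0 1 + t1 * k 0 0).
apply: (@leq_trans #|[set a0; a1]|); last by rewrite cards2; case: (_ != _).
apply: subset_leq_card; apply/subsetP => a /TP[na ka].
have perp : k 0 0 * (a 0 0 - a0 0 0) + k 0 1 * (a 0 1 - a0 0 1) = 0.
  by apply: (mulfI two0); rewrite mulr0 -(subrr N) {1}ka ka0; ring.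
have Ntau : N * tau a = k 0 0 * (a 0 1 - a0 0 1) - k 0 1 * (a 0 0 - a0 0 0).
  by rewrite /tau mulrC divfK.
have Nt1 : N * t1 = - (2 * (k 0 0 * a0 0 1 - k 0 1 * a0 0 0)) by rewrite /t1 mulrC divfK.
have e0 : a 0 0 = a0 0 0 - tau a * k 0 1.
  apply/eqP; rewrite -subr_eq0 -(mulrI_eq0 _ (mulfI N0)); apply/eqP.
  transitivity (N * (a 0 0 - a0 0 0) + N * tau a * k 0 1); first by ring.
  rewrite Ntau; transitivity (k 0 0 * (k 0 0 * (a 0 0 - a0 0 0) + k 0 1 * (a 0 1 - a0 0 1))).
    by rewrite /N; ring.
  by rewrite perp mulr0.
have e1 : a 0 1 = a0 0 1 + tau a * k 0 0.
  apply/eqP; rewrite -subr_eq0 -(mulrI_eq0 _ (mulfI N0)); apply/eqP.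
  transitivity (N * (a 0 1 - a0 0 1) - N * tau a * k 0 0); first by ring.
  rewrite Ntau; transitivity (k 0 1 * (k 0 0 * (a 0 0 - a0 0 0) + k 0 1 * (a 0 1 - a0 0 1))).
    by rewrite /N; ring.
  by rewrite perp mulr0.
have : tau a * (tau a - t1) = 0.
  apply/eqP; rewrite -(mulrI_eq0 _ (mulfI N0)); apply/eqP.
  transitivity (tau a * (N * tau a - N * t1)); first by ring.
  rewrite Nt1 -(subrr r) -{1}na -na0 e0 e1 /N; ring.
move/eqP; rewrite mulf_eq0 subr_eq0 !inE => /orP[] /eqP t.
  by apply/orP; left; apply/eqP/row2P; rewrite ?e0 ?e1 t mul0r ?subr0 ?addr0.
by apply/orP; right; apply/eqP/row2P; rewrite mxE /= ?e0 ?e1 t.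
Qed.

(* Fourth-moment argument: the extension [ext] of [conj (ft E)] from the circle has
   [L^4] norm controlled by the number of ways to write [k = a + (k - a)] on it. *)
Lemma sphere_mass_circle E r : r != 0 ->
  sphere_mass psi E r ^+ 2 <= 3 * q ^+ 2 * #|E|%:R ^+ 3.
Proof.
move=> r0; set M := sphere_mass psi E r; set e : R := #|E|%:R.
have M_ge0 : 0 <= M by apply: sphere_mass_ge0.
have e_ge0 : 0 <= e by exact: ler0n.
pose g m := normc (ft psi E m).
have g_ge0 m : 0 <= g m by exact: normc_ge0.
have ME : M = \sum_(m | sqnorm m == r) g m ^+ 2 by [].
pose ext x : R[i] := \sum_(m | sqnorm m == r) conjc (ft psi E m) * psi (dotv m x).
pose c k : R[i] := \sum_(a | (sqnorm a == r) && (sqnorm (k - a) == r))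
                     conjc (ft psi E a) * conjc (ft psi E (k - a)).
have M_ext : M <= \sum_(x in E) normc (ext x).
  have : ((M)%:C)%C = \sum_(x in E) ext x.
    rewrite rmorph_sum /= exchange_big /=; apply: eq_bigr => m _.
    by rewrite sqr_normcC mulrC {2}/ft mulr_sumr.
  move/(congr1 (@normc R)); rewrite normcR ger0_norm // => ->; exact: le_normc_sum.
have ext_sqr x : ext x ^+ 2 = \sum_k c k * psi (dotv x k).
  rewrite expr2 {1}/ext mulr_suml.
  transitivity (\sum_(a | sqnorm a == r) \sum_k (if sqnorm (k - a) == r then
      conjc (ft psi E a) * conjc (ft psi E (k - a)) * psi (dotv x k) else 0)).
    apply: eq_bigr => a _; rewrite /ext mulr_sumr -big_mkcond /=.
    rewrite [RHS](reindex_inj (addrI a)) /=; apply: eq_big => [b|b _].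
      by rewrite addrAC subrr add0r.
    by rewrite addrAC subrr add0r mulrACA -psiD -dotvDl dotvC.
  rewrite exchange_big; apply: eq_bigr => k _.
  by rewrite /c mulr_suml big_mkcondr.
have ext4 : \sum_x normc (ext x) ^+ 4 = q ^+ 2 * \sum_k normc (c k) ^+ 2.
  have := parseval (orth_dotv psiP (d := 2)) c; rewrite natrX => <-.
  by apply: eq_bigr => x _; rewrite -ext_sqr normcX -exprM.
have c_le k : normc (c k) <=
    \sum_(a | (sqnorm a == r) && (sqnorm (k - a) == r)) g a * g (k - a).
  apply: le_trans (le_normc_sum _ _ _) _; apply: ler_sum => a _.
  by rewrite normcM !normc_conj.
(* For [k = 0] the two circles coincide and the two-point bound fails; Cauchy-Schwarz with the
   symmetry [a -> - a] gives [M ^+ 2] instead. *)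
have c0_le : normc (c 0) ^+ 2 <= M ^+ 2.
  have sum_ge0 : 0 <= \sum_(a | (sqnorm a == r) && (sqnorm (0 - a) == r)) g a * g (0 - a).
    by apply: sumr_ge0 => a _; rewrite mulr_ge0.
  apply: (@le_trans _ _ ((\sum_(a | (sqnorm a == r) && (sqnorm (0 - a) == r)) g a * g (0 - a)) ^+ 2)).
    by rewrite lerXn2r ?nnegrE ?normc_ge0.
  apply: le_trans (cauchy_schwarz_sum _ _ _) _.
  rewrite (eq_bigl (fun a => sqnorm a == r)) => [|a]; last by rewrite sub0r sqnormN andbb.
  rewrite expr2; apply: ler_wpM2l => //.
  rewrite (eq_bigl (fun a => sqnorm a == r)) => [|a]; last by rewrite sub0r sqnormN andbb.
  rewrite ME [leRHS](reindex_inj oppr_inj) le_eqVlt; apply/orP; left; apply/eqP.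
  by apply: eq_big => a; rewrite ?sqnormN // sub0r.
have ck_le k : k != 0 -> normc (c k) ^+ 2 <=
    2 * \sum_(a | (sqnorm a == r) && (sqnorm (k - a) == r)) (g a * g (k - a)) ^+ 2.
  move=> k0; pose P a := (sqnorm a == r) && (sqnorm (k - a) == r).
  apply: (@le_trans _ _ ((\sum_(a | P a) 1 * (g a * g (k - a))) ^+ 2)).
    rewrite lerXn2r ?nnegrE ?normc_ge0 //.
      by apply: sumr_ge0 => a _; rewrite mul1r mulr_ge0.
    by under eq_bigr do rewrite mul1r; apply: c_le.
  apply: le_trans (cauchy_schwarz_sum _ _ _) _; apply: ler_wpM2r.
    by apply: sumr_ge0 => a _; apply: sqr_ge0.
  under eq_bigr do rewrite expr1n.
  rewrite sumr_const ler_nat; apply: leq_trans (card_circle_meet k0 r0).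
  by rewrite cardsE.
have sum_pairs : \sum_k \sum_(a | (sqnorm a == r) && (sqnorm (k - a) == r))
    (g a * g (k - a)) ^+ 2 = M ^+ 2.
  under eq_bigr => k _ do rewrite big_mkcondr.
  rewrite exchange_big expr2 {1}ME mulr_suml; apply: eq_bigr => a _ /=.
  rewrite ME mulr_sumr -big_mkcond (reindex_inj (addrI a)) /=.
  by apply: eq_big => [b|b _]; rewrite addrAC subrr add0r // exprMn.
have sum_c : \sum_k normc (c k) ^+ 2 <= 3 * M ^+ 2.
  rewrite (bigD1 0) //=.
  have -> : 3 * M ^+ 2 = M ^+ 2 + 2 * M ^+ 2 by ring.
  apply: lerD => //; apply: (@le_trans _ _ (\sum_(k | k != 0) (2 *
    \sum_(a | (sqnorm a == r) && (sqnorm (k - a) == r)) (g a * g (k - a)) ^+ 2))).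
    exact: ler_sum.
  rewrite -mulr_sumr ler_pM2l // -sum_pairs [leRHS](bigD1 0) //= lerDr.
  by apply: sumr_ge0 => a _; apply: sqr_ge0.
have step1 : M ^+ 2 <= e * \sum_(x in E) normc (ext x) ^+ 2.
  apply: (@le_trans _ _ ((\sum_(x in E) 1 * normc (ext x)) ^+ 2)).
    under eq_bigr do rewrite mul1r.
    have sum_ge0 : 0 <= \sum_(x in E) normc (ext x).
      by apply: sumr_ge0 => x _; apply: normc_ge0.
    by rewrite lerXn2r ?nnegrE.
  apply: le_trans (cauchy_schwarz_sum _ _ _) _.
  by under eq_bigr do rewrite expr1n; rewrite sumr_const.
have step2 : (\sum_(x in E) normc (ext x) ^+ 2) ^+ 2 <= e * (q ^+ 2 * (3 * M ^+ 2)).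
  apply: (@le_trans _ _ ((\sum_(x in E) 1 * normc (ext x) ^+ 2) ^+ 2)).
    by under [in leRHS]eq_bigr do rewrite mul1r.
  apply: le_trans (cauchy_schwarz_sum _ _ _) _.
  under eq_bigr do rewrite expr1n; rewrite sumr_const; apply: ler_wpM2l => //.
  apply: (@le_trans _ _ (\sum_x normc (ext x) ^+ 4)).
    under eq_bigr do rewrite -exprM.
    rewrite [leRHS](bigID [in E]) /= lerDl.
    by apply: sumr_ge0 => x _; rewrite exprn_ge0 ?normc_ge0.
  by rewrite ext4; apply: ler_wpM2l => //; apply: sqr_ge0.
(* [step1] and [step2] combine to [M ^ 4 <= 3 * q ^ 2 * e ^ 3 * M ^ 2], from which [M ^ 2] is to be
   cancelled. *)
have [->|M0] := eqVneq M 0.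
  by rewrite expr0n /= !mulr_ge0 ?exprn_ge0 // ler0n.
have M2_gt0 : 0 < M ^+ 2 by rewrite exprn_gt0 // lt_def M0.
rewrite -(ler_pM2r M2_gt0).
move: step1 step2; set S2 := \sum_(x in E) _ => s1 s2.
have S2_ge0 : 0 <= S2 by apply: sumr_ge0 => x _; apply: sqr_ge0.
apply: (@le_trans _ _ ((e * S2) ^+ 2)).
  by rewrite -expr2 lerXn2r ?nnegrE ?mulr_ge0 ?sqr_ge0.
rewrite exprMn; apply: (@le_trans _ _ (e ^+ 2 * (e * (q ^+ 2 * (3 * M ^+ 2))))).
  by apply: ler_wpM2l => //; apply: sqr_ge0.
by rewrite le_eqVlt; apply/orP; left; apply/eqP; ring.
Qed.

End CircleMass.

(** * Distance sets *)

(** Compares [D] with a target [mn] through the second moment [T] without dividing by [T]; each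
    bound below reduces to checking [mn * T <= c * x ^+ 2]. *)
Lemma le_of_energy (R : realFieldType) (D x T mn a c : R) :
  0 <= D -> 0 < x -> 0 <= mn ->
  a * x ^+ 2 <= D * T -> mn * T <= c * x ^+ 2 -> a * mn <= c * D.
Proof.
move=> D0 x0 mn0 xT Tx; have x2 : 0 < x ^+ 2 by rewrite exprn_gt0.
rewrite -(ler_pM2r x2); apply: (@le_trans _ _ (mn * (D * T))).
  by rewrite mulrAC [a * x ^+ 2 * _]mulrC; apply: ler_wpM2l.
by rewrite mulrCA -mulrA [c * _]mulrC -mulrA [x ^+ 2 * c]mulrC; apply: ler_wpM2l.
Qed.

Section DistanceSets.
Variables (R : rcfType) (K : finFieldType) (psi : K -> R[i]).
Hypotheses (psiP : nontrivial_char psi) (oddK : odd #|K|).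
Variable d : nat.
Variables E G : {set 'rV[K]_d}.
Let q : R := #|K|%:R.
Let e : R := #|E|%:R.
Let f : R := #|G|%:R.
Let D : R := #|dist_set E G|%:R.
Let q_ge3 : 3 <= q.
Proof.
by rewrite ler_nat; move: oddK (finNzRing_gt1 K); case: #|K| => [|[|[]]].
Qed.
Let q_gt0 : 0 < q. Proof. by have := q_ge3; lra. Qed.
Let e_ge0 : 0 <= e. Proof. exact: ler0n. Qed.
Let f_ge0 : 0 <= f. Proof. exact: ler0n. Qed.
Let D_ge0 : 0 <= D. Proof. exact: ler0n. Qed.
Let sum_nu : \sum_t (dist_count E G t)%:R = e * f.
Proof. by rewrite -natr_sum sum_dist_count natrM. Qed.

Lemma dist_set_energy : (e * f) ^+ 2 <= D * ((e * f) ^+ 2 / q + q ^+ d * (e * f)).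
Proof.
have := dist_set_lower_bound R E G xpredT; rewrite sum_nu => /le_trans-> //.
by apply: ler_wpM2l => //; apply: (sum_dist_count_sqr_le psiP oddK E G).
Qed.

(** At least half of the pairs lie at nonzero distance, whence the factor [1 / 4] after squaring. *)
Lemma dist_set_energy_nonzero (M : R) : ~~ odd d -> 16 * q ^+ d <= e * f ->
    (forall r, r != 0 -> sphere_mass psi E r <= M) ->
  1 / 4 * (e * f) ^+ 2 <=
    D * (3 * ((e * f) ^+ 2 / q + q ^+ d / q * (e * f) + M * f)).
Proof.
move=> d2 le16 leM.
have energy := sum_dist_count_nonzero_le psiP oddK G d2 leM.
have := dist_set_lower_bound R E G (fun t => t != 0) => lb.
apply: le_trans (le_trans lb (ler_wpM2l D_ge0 energy)).
have Z_gt0 : 0 < q ^+ d by rewrite exprn_gt0.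
have X_ge0 : 0 <= e * f by rewrite mulr_ge0.
have sqrt_le : Num.sqrt (q ^+ d * e * f) <= e * f / 4.
  rewrite -[leRHS]ger0_norm; last by lra.
  rewrite -sqrtr_sqr; apply: ler_wsqrtr; rewrite -mulrA.
  move: (e * f) (q ^+ d) X_ge0 le16 => X Z X0 XZ; nra.
(* The factor 16 gives [sqrt (q^d e f) <= e f / 4], so [nu 0] is at most
   [e f * (1 / 4 + 3 / (4 q))], and [q >= 3] makes this at most half. *)
have nu0 : (dist_count E G 0)%:R <= e * f / 2 :> R.
  rewrite -(ler_pM2l q_gt0); apply: le_trans (dist_count0_le psiP oddK E G) _.
  move: sqrt_le; rewrite -/q -/e -/f; move: (Num.sqrt _) (e * f) X_ge0 => z X X0 zX.
  have := q_ge3; nra.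
have -> : 1 / 4 * (e * f) ^+ 2 = (e * f / 2) ^+ 2 by field.
move: sum_nu; rewrite (bigD1 0) //= => sumE.
have S_ge0 : 0 <= \sum_(t | t != 0) (dist_count E G t)%:R :> R by apply: sumr_ge0.
by rewrite lerXn2r ?nnegrE //; lra.
Qed.

Lemma dist_set_large : 16 * q ^+ d <= e * f ->
  1 / 144 * Num.min q (2 * e * f / q ^+ d) <= D.
Proof.
move=> le16; have Z_gt0 : 0 < q ^+ d by rewrite exprn_gt0.
have X_gt0 : 0 < e * f by lra.
set mn := Num.min _ _.
have mn_q : mn <= q by rewrite ge_min lexx.
have mn_Z : mn * q ^+ d <= 2 * (e * f).
  by rewrite -ler_pdivlMr // mulrA ge_min lexx orbT.
have mn_ge0 : 0 <= mn by rewrite le_min ltW //= divr_ge0 ?(ltW Z_gt0) // -mulrA; lra.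
have energy := dist_set_energy.
have := @le_of_energy _ _ (e * f) _ mn 1 3 D_ge0 X_gt0 mn_ge0; rewrite mul1r => /(_ _ energy).
rewrite mul1r => H; have : mn <= 3 * D; last by lra.
apply: H; rewrite mulrDr [mn * (_ / q)]mulrA [mn * (_ * _)]mulrA.
have : mn * (e * f) ^+ 2 / q <= (e * f) ^+ 2.
  by rewrite ler_pdivrMr // mulrC ler_wpM2l ?sqr_ge0.
have : mn * q ^+ d * (e * f) <= 2 * (e * f) * (e * f) by rewrite ler_pM2r.
by rewrite expr2; lra.
Qed.

Section EvenDimension.
Hypotheses (d_even : ~~ odd d) (d_ge2 : (2 <= d)%N) (le16 : 16 * q ^+ d <= e * f).
Let w : R := Num.sqrt (q ^+ (d - 1)).
Let Z_gt0 : 0 < q ^+ d. Proof. by rewrite exprn_gt0. Qed.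
Let X_gt0 : 0 < e * f. Proof. by apply: lt_le_trans le16; rewrite mulr_gt0. Qed.
Let w_ge0 : 0 <= w. Proof. exact: sqrtr_ge0. Qed.
Let wE : q ^+ d / q = w ^+ 2.
Proof.
rewrite sqr_sqrtr ?exprn_ge0 ?ltW //; apply: (mulIf (lt0r_neq0 q_gt0)).
by rewrite divfK ?gt_eqF // -exprSr subn1 prednK // ltnW.
Qed.

Let energy : 1 / 4 * (e * f) ^+ 2 <=
  D * (3 * ((e * f) ^+ 2 / q + 2 * w ^+ 2 * (e * f) + 3 * w * e * (e * f))).
Proof.
have mass r : r != 0 -> sphere_mass psi E r <= w ^+ 2 * e + 3 * w * e ^+ 2.
  by move=> r0; rewrite -wE; apply: sphere_mass_even => //; apply: ltnW.
have := dist_set_energy_nonzero d_even le16 mass; rewrite wE.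
by congr (_ <= D * (3 * _)); ring.
Qed.

(** As [e < w], both error terms are of order [q ^+ d * (e * f)], at most [5 / 16] of [(e * f) ^+ 2]
    altogether; [3 * (1 + 5 / 16)] is below 4. *)
Lemma dist_set_small : e < w -> q / 144 <= D.
Proof.
move=> ew; have := @le_of_energy _ _ (e * f) _ q _ 4 D_ge0 X_gt0 (ltW q_gt0) energy.
suff H : q * (3 * ((e * f) ^+ 2 / q + 2 * w ^+ 2 * (e * f) + 3 * w * e * (e * f)))
    <= 4 * (e * f) ^+ 2 by move=> /(_ H); have := D_ge0; lra.
have -> : q * (3 * ((e * f) ^+ 2 / q + 2 * w ^+ 2 * (e * f) + 3 * w * e * (e * f)))
   = 3 * ((e * f) ^+ 2 + 2 * (q * w ^+ 2) * (e * f) + 3 * (q * (w * e)) * (e * f)).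
  by field; rewrite gt_eqF.
have qw : q * w ^+ 2 = q ^+ d by rewrite -wE mulrC divfK ?gt_eqF.
have : q * (w * e) <= q * w ^+ 2 by rewrite ler_pM2l // expr2 ler_wpM2l // ltW.
rewrite qw; move: (q * (w * e)) (q ^+ d) (e * f) le16 X_gt0 => a Z X h1 h2 h3; nra.
Qed.

(** As [w <= e], the term in [w ^+ 2] is dominated by the one in [w * e]; the three contributions
    add up to [3 + 3 + 9 / 2], below 12. *)
Lemma dist_set_medium : w <= e -> 1 / 144 * Num.min q (f / (2 * w)) <= D.
Proof.
move=> we; set mn := Num.min _ _.
have w_gt0 : 0 < w by rewrite sqrtr_gt0 exprn_gt0.
have mn_q : mn <= q by rewrite ge_min lexx.
have mn_w : mn * (2 * w) <= f.
  by rewrite -ler_pdivlMr ?ge_min ?lexx ?orbT //; lra.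
have mn_ge0 : 0 <= mn by rewrite le_min ltW //= divr_ge0 //; lra.
have := @le_of_energy _ _ (e * f) _ mn _ 12 D_ge0 X_gt0 mn_ge0 energy.
suff H : mn * (3 * ((e * f) ^+ 2 / q + 2 * w ^+ 2 * (e * f) + 3 * w * e * (e * f)))
    <= 12 * (e * f) ^+ 2 by move=> /(_ H); have := D_ge0; lra.
have h1 : mn * ((e * f) ^+ 2 / q) <= (e * f) ^+ 2.
  by rewrite mulrA ler_pdivrMr // mulrC ler_wpM2l ?sqr_ge0.
have h2 : mn * (2 * w) * e <= f * e by apply: ler_wpM2r.
have h3 : mn * (2 * w) * w <= mn * (2 * w) * e.
  by apply: ler_wpM2l => //; rewrite mulr_ge0 //; lra.
have h4 : mn * (2 * w) * e * (e * f) <= f * e * (e * f) by rewrite ler_pM2r.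
have h5 : mn * (2 * w) * w * (e * f) <= mn * (2 * w) * e * (e * f) by rewrite ler_pM2r.
have -> : mn * (3 * ((e * f) ^+ 2 / q + 2 * w ^+ 2 * (e * f) + 3 * w * e * (e * f)))
  = 3 * (mn * ((e * f) ^+ 2 / q)) + 3 * (mn * (2 * w) * w * (e * f))
    + 9 / 2 * (mn * (2 * w) * e * (e * f)) by field; rewrite gt_eqF.
have h6 : f * e * (e * f) = (e * f) ^+ 2 by ring.
by have := sqr_ge0 (e * f); lra.
Qed.

End EvenDimension.

End DistanceSets.

Section PlaneDistanceSets.
Variables (R : rcfType) (K : finFieldType) (psi : K -> R[i]).
Hypotheses (psiP : nontrivial_char psi) (oddK : odd #|K|).
Variables E G : {set 'rV[K]_2}.
Let q : R := #|K|%:R.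
Let e : R := #|E|%:R.
Let f : R := #|G|%:R.
Let D : R := #|dist_set E G|%:R.
Let q_gt0 : 0 < q. Proof. by rewrite ltr0n (ltnW (finNzRing_gt1 K)). Qed.
Let e_ge0 : 0 <= e. Proof. exact: ler0n. Qed.
Let f_ge0 : 0 <= f. Proof. exact: ler0n. Qed.
Let D_ge0 : 0 <= D. Proof. exact: ler0n. Qed.
Let s3 : R := Num.sqrt 3.
Let re : R := Num.sqrt e.
Let s3_ge1 : 1 <= s3.
Proof. by rewrite -sqrtr1 ler_wsqrtr // ler1n. Qed.
Let s3E : s3 ^+ 2 = 3. Proof. by rewrite sqr_sqrtr. Qed.
Let reE : re ^+ 2 = e. Proof. by rewrite sqr_sqrtr. Qed.
Let re_ge0 : 0 <= re. Proof. exact: sqrtr_ge0. Qed.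

Let mass r : r != 0 -> sphere_mass psi E r <= s3 * q * e * re.
Proof.
move=> r0; have s3_ge0 : 0 <= s3 by exact: sqrtr_ge0.
rewrite -(@ler_pXn2r _ 2) ?nnegrE ?sphere_mass_ge0 //; last first.
  by rewrite !mulr_ge0 // ltW.
have -> : (s3 * q * e * re) ^+ 2 = 3 * q ^+ 2 * e ^+ 3.
  by rewrite !exprMn s3E reE; ring.
exact: sphere_mass_circle.
Qed.

Lemma plane_dist_set : 16 * q ^+ 2 <= e * f ->
  1 / 72 * Num.min (q / 2) (re * f / (s3 * q)) <= D.
Proof.
move=> le16; set mn := Num.min _ _.
have X_gt0 : 0 < e * f by apply: lt_le_trans le16; rewrite mulr_gt0 ?exprn_gt0.
have e_ge1 : 1 <= e.
  by rewrite ler1n lt0n; apply: contraTneq X_gt0; rewrite /e => ->; rewrite mul0r ltxx.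
have re_ge1 : 1 <= re by rewrite -sqrtr1 ler_wsqrtr.
have mn_q : mn <= q / 2 by rewrite ge_min lexx.
have sq_gt0 : 0 < s3 * q by rewrite mulr_gt0 //; have := s3_ge1; lra.
have mn_s : mn * (s3 * q) <= re * f by rewrite -ler_pdivlMr // ge_min lexx orbT.
have mn_ge0 : 0 <= mn.
  by rewrite le_min; apply/andP; split; [have := q_gt0; lra|rewrite divr_ge0 ?(ltW sq_gt0) // mulr_ge0].
have energy := dist_set_energy_nonzero psiP oddK (isT : ~~ odd 2) le16 mass.
have := le_of_energy (c := 8) D_ge0 X_gt0 mn_ge0 energy.
set T := (X in mn * X <= _); suff H : mn * T <= 8 * (e * f) ^+ 2.
  by move=> /(_ H); rewrite -/D; have := D_ge0; lra.
have h1 : mn * ((e * f) ^+ 2 / q) <= (e * f) ^+ 2 / 2.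
  rewrite mulrA ler_pdivrMr // mulrAC -[leRHS]mulrA [leRHS]mulrC.
  by apply: ler_wpM2r; rewrite ?sqr_ge0.
have h2 : mn * q * (e * f) <= (e * f) ^+ 2.
  rewrite [leRHS]expr2 ler_pM2r //; apply: (@le_trans _ _ (mn * (s3 * q))).
    by apply: ler_wpM2l => //; rewrite ler_peMl // ltW.
  apply: le_trans mn_s _; apply: ler_wpM2r => //.
  by rewrite -reE expr2 ler_peMl.
have h3 : mn * (s3 * q) * (e * re * f) <= (e * f) ^+ 2.
  have -> : (e * f) ^+ 2 = re * f * (e * re * f) by rewrite -reE; ring.
  by apply: ler_wpM2r; rewrite ?mulr_ge0.
have -> : mn * T = 3 * (mn * ((e * f) ^+ 2 / q)) + 3 * (mn * q * (e * f))
   + 3 * (mn * (s3 * q) * (e * re * f)).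
  by rewrite /T; field; rewrite gt_eqF.
by have := sqr_ge0 (e * f); lra.
Qed.

Lemma sqnorm2_eq0 (x : 'rV[K]_2) : (forall z : K, z ^+ 2 != -1) -> sqnorm x = 0 -> x = 0.
Proof.
move=> nsq; rewrite sqnorm2E => /eqP; rewrite addr_eq0 => /eqP x2.
have x1 : x 0 1 = 0.
  apply/eqP; apply: contraT => x1; have := nsq (x 0 0 / x 0 1).
  by rewrite expr_div_n x2 mulNr divff ?eqxx // expf_neq0.
have x0 : x 0 0 = 0 by apply/eqP; rewrite -sqrf_eq0 x2 x1 expr0n oppr0.
by apply: row2P; rewrite mxE.
Qed.

(** Without isotropic vectors the zero sphere is the origin, so the zero-radius term equals [e * f]
    exactly. No distance has to be discarded, hence no size condition on [E] and [G]. *)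
Lemma plane_dist_set_nonsquare : E != set0 -> G != set0 -> (forall x : K, x ^+ 2 != -1) ->
  Num.min (q / 2) (re * f / (2 * (s3 + 1) * q)) <= D.
Proof.
rewrite -!card_gt0 => E0 G0 nsq; set mn := Num.min _ _.
have e_gt0 : 0 < e by rewrite ltr0n.
have f_gt0 : 0 < f by rewrite ltr0n.
have X_gt0 : 0 < e * f by rewrite mulr_gt0.
have mn_q : mn <= q / 2 by rewrite ge_min lexx.
have sq_gt0 : 0 < 2 * (s3 + 1) * q by rewrite mulr_gt0 //; have := s3_ge1; lra.
have mn_s : mn * (2 * (s3 + 1) * q) <= re * f by rewrite -ler_pdivlMr // ge_min lexx orbT.
have mn_ge0 : 0 <= mn.
  by rewrite le_min; apply/andP; split; [have := q_gt0; lra|rewrite divr_ge0 ?(ltW sq_gt0) // mulr_ge0].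
have corr0 : normc (sphere_corr psi E G 0) ^+ 2 = (e * f) ^+ 2.
  congr (_ ^+ 2); rewrite /sphere_corr (big_pred1 0) => [|m]; last first.
    apply/eqP/eqP => [/(sqnorm2_eq0 nsq)//|->].
    by rewrite sqnorm2E !mxE expr0n addr0.
  have ft0 (F : {set 'rV[K]_2}) : ft psi F 0 = #|F|%:R.
    rewrite /ft -sum1_card natr_sum; apply: eq_bigr => x _.
    rewrite /dotv big1 => [|i _]; last by rewrite mxE mul0r.
    by case: psiP.
  by rewrite !ft0 normcM normc_conj !normc_nat.
have le_q2 (F : {set 'rV[K]_2}) : #|F|%:R <= q ^+ 2.
  rewrite -natrX ler_nat; apply: leq_trans (max_card _) _.
  by rewrite card_mx mul1n.
have re_q : re <= q.
  by rewrite -[q]ger0_norm ?(ltW q_gt0) // -sqrtr_sqr; apply: ler_wsqrtr; apply: le_q2.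
(* From [re <= q] and [f <= q ^+ 2]: the zero radius costs no more than [q * e * re * f], which is
   the summand 1 in [s3 + 1]. *)
have small : (e * f) ^+ 2 / q ^+ 2 <= q * e * re * f.
  rewrite ler_pdivrMr ?exprn_gt0 //.
  have -> : (e * f) ^+ 2 = re * f * (e * re * f) by rewrite -reE; ring.
  have -> : q * e * re * f * q ^+ 2 = q * q ^+ 2 * (e * re * f) by ring.
  apply: ler_wpM2r; first by rewrite !mulr_ge0.
  by apply: ler_pM => //; apply: le_q2.
have corr : (\sum_r normc (sphere_corr psi E G r) ^+ 2) / q ^+ 2 <= (s3 + 1) * q * (e * re * f).
  rewrite (bigD1 0) //= corr0 mulrDl.
  have -> : (s3 + 1) * q * (e * re * f) = q * e * re * f + s3 * q * e * re * f by ring.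
  apply: lerD => //; rewrite ler_pdivrMr ?exprn_gt0 //.
  have := sum_corr_nonzero_le psiP G mass; rewrite -/q -/f.
  by rewrite [q ^+ 2 * f]mulrC mulrA.
have energy : 1 * (e * f) ^+ 2 <= D * ((e * f) ^+ 2 / q + (s3 + 1) * q * (e * re * f)).
  rewrite mul1r; have := dist_set_lower_bound R E G xpredT.
  rewrite -natr_sum sum_dist_count natrM => /le_trans-> //; apply: ler_wpM2l => //.
  apply: le_trans (sum_dist_count_sqr_corr psiP oddK E G) _.
  by rewrite lerD2l.
have := le_of_energy (c := 1) D_ge0 X_gt0 mn_ge0 energy.
rewrite !mul1r; apply; rewrite mulrDr.
have h1 : mn * ((e * f) ^+ 2 / q) <= (e * f) ^+ 2 / 2.
  rewrite mulrA ler_pdivrMr // mulrAC -[leRHS]mulrA [leRHS]mulrC.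
  by apply: ler_wpM2r; rewrite ?sqr_ge0.
have h3 : mn * (2 * (s3 + 1) * q) * (e * re * f) <= (e * f) ^+ 2.
  have -> : (e * f) ^+ 2 = re * f * (e * re * f) by rewrite -reE; ring.
  by apply: ler_wpM2r; rewrite ?mulr_ge0.
have : mn * ((s3 + 1) * q * (e * re * f)) = mn * (2 * (s3 + 1) * q) * (e * re * f) / 2.
  by field.
by lra.
Qed.

End PlaneDistanceSets.

Theorem mainTheorem2 (K : finFieldType) (R : rcfType) (d : nat)
    (E G : {set 'rV[K]_d}) :
  odd #|K| ->
  let q : R := (#|K|)%:R in
  let e : R := (#|E|)%:R in
  let f : R := (#|G|)%:R in
  let D : R := (#|dist_set E G|)%:R in
  [/\
   (* (1) *)
   (~~ odd d -> (2 <= d)%N -> (16 * #|K| ^ d <= #|E| * #|G|)%N ->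
     [/\ ((1 <= #|E|)%N -> e < Num.sqrt (q ^+ (d - 1)) -> q / 144 <= D),
         (Num.sqrt (q ^+ (d - 1)) <= e -> e < Num.sqrt (q ^+ (d + 1)) ->
            1 / 144 * Num.min q (f / (2 * Num.sqrt (q ^+ (d - 1)))) <= D)
       & (Num.sqrt (q ^+ (d + 1)) <= e -> e <= q ^+ d ->
            1 / 144 * Num.min q (2 * e * f / q ^+ d) <= D)]),
   (* (2) *)
   (d = 2%N -> (16 * #|K| ^ 2 <= #|E| * #|G|)%N ->
     1 / 72 * Num.min (q / 2) (Num.sqrt e * f / (Num.sqrt 3 * q)) <= D)
  & (* (3) *)
   (d = 2%N -> E != set0 -> G != set0 -> (forall x : K, x ^+ 2 != -1) ->
     Num.min (q / 2) (Num.sqrt e * f / (2 * (Num.sqrt 3 + 1) * q)) <= D)].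
Proof.
move=> oddK q e f D.
have [psi psiP] := exists_nontrivial_char K (pchar_num R[i]).
have le16 k : (16 * #|K| ^ k <= #|E| * #|G|)%N -> 16 * q ^+ k <= e * f.
  by rewrite -(ler_nat R) !natrM natrX.
split=> [d2 d_ge2 /le16 H|d2 /le16 H|d2 E0 G0 nsq].
- split=> [_ ew|we _|_ _].
  + exact: (dist_set_small psiP).
  + exact: (dist_set_medium psiP).
  + exact: (dist_set_large psiP).
- by subst d; apply: (plane_dist_set psiP).
by subst d; apply: (plane_dist_set_nonsquare psiP).
Qed.
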